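(* Let $\{g_t,\ t\in(-\epsilon,\epsilon)\}\subset\mathrm{Riem}(M,\mathcal V,g_0)$ be a variation such that $\pi:(M,g_t)\to(N,g_N)$ is a Riemannian submersion for all $t\in(-\epsilon,\epsilon)$ and, for every vertical $X$, $$B_t^\sharp X=\sum_{i=n+1}^{n+p}g_0(V_i,X)\,P^t_{\mathcal H}\pi^*W_i,$$ where $\{W_{n+1},\dots,W_{n+p}\}$ are $g_N$-orthonormal vector fields on $N$ and $\{V_{n+1},\dots,V_{n+p}\}$ are bounded vertical vector fields (possibly depending on $t$) whose restrictions to every fiber $\mathcal F_x$ are Killing fields on $(\mathcal F_x,g_0|_{\mathcal F_x})$. Let the fibers of $\pi:(M,g_0)\to(N,g_N)$ be totally geodesic. Write $W_i^t=P^t_{\mathcal H}\pi^*W_i$. Then for all $U\in\mathfrak X_{\mathcal V}$ and all $i\in\{n+1,\dots,n+p\}$ we have $$\partial_t\sec_{(M,g_t)}(W_i^t,U)=\frac12\sum_{j=n+1}^{n+p}g_t([W_i^t,W_j^t],U)\Big(\sum_{k=n+1}^{n+p}g_N([W_i,W_j],W_k)g_0(V_k,U)-g_t([V_i,W_j^t]+[W_i^t,V_j],U)\Big)$$ and $$\partial^2_{t}\sec_{(M,g_t)}(W_i^t,U)=\frac12\sum_{j=n+1}^{n+p}\Big(\sum_{l=n+1}^{n+p}g_N([W_i,W_j],W_l)g_0(V_l,U)-g_t([V_i,W_j^t]+[W_i^t,V_j],U)\Big)^2$$ $$+\frac12\sum_{j=n+1}^{n+p}g_t([W_i^t,W_j^t],U)\Big(\sum_{l=n+1}^{n+p}g_N([W_i,W_j],W_l)g_0(\partial_tV_l,U)-g_t([\partial_tV_i,W_j^t],U)-g_t([W_i^t,\partial_tV_j],U)+2g_t([V_i,V_j],U)\Big).$$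 (Functions on $N$ are pulled back to $M$.)
   Context: $M$, $N$ are smooth, connected, oriented manifolds, $\dim M=n+p$, $\dim N=p$; all functions and tensor fields are smooth. $\pi:(M,g_0)\to(N,g_N)$ is a Riemannian submersion with fibers $\mathcal F_x=\pi^{-1}(\{x\})$; $\mathcal V$ is the vertical distribution and $\mathfrak X_{\mathcal V}$ the set of vertical vector fields. $\mathrm{Riem}(M,\mathcal V,g_0)$ is the set of metrics $g$ on $M$ with $g(X,Y)=g_0(X,Y)$ for all vertical $X,Y$. A variation of $g_0$ is a one-parameter family $g_t$ in this set (equal to $g_0$ at $t=0$), smooth in $t$. $\mathcal H(t)$ is the $g_t$-orthogonal complement of $\mathcal V$; $P^t_{\mathcal V},P^t_{\mathcal H}$ are the $g_t$-orthogonal projections onto $\mathcal V$, $\mathcal H(t)$. $\pi:(M,g_t)\to(N,g_N)$ is a Riemannian submersion if $g_t(X,Y)=g_N(\pi_*X,\pi_*Y)$ for $X,Y$ in $\mathcal H(t)$. $B_t=\partial_tg_t$ and $g_t(B_t^\sharp X,Y)=B_t(X,Y)$. For a vector field $W$ on $N$, $\pi^*W$ is its $g_0$-horizontal lift. A vector field $V$ is bounded if $g_0(V,V)$ is a bounded function. $\sec_{(M,g_t)}(X,Y)$ is the sectional curvature of the plane spanned by $X,Y$. For such submersions with totally geodesic fibers, curvatures of planes spanned by $X$ in $\mathcal H(t)$ and $U$ in $\mathcal V$ are given by the formula $\sec_{(M,g_t)}(X,U)=g_t(\mathcal A^t_XU,\mathcal A^t_XU)$, where $\mathcal A^t_XY=P^t_{\mathcal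 V}\nabla^t_{P^t_{\mathcal H}X}P^t_{\mathcal H}Y+P^t_{\mathcal H}\nabla^t_{P^t_{\mathcal H}X}P^t_{\mathcal V}Y$ and $\nabla^t$ is the Levi-Civita connection of $g_t$.
   Formalization: In both formulas sec(W_i^t,U) is replaced by g_0(U,U)·sec(W_i^t,U), since the right-hand sides are quadratic in U while sec is unchanged when U is rescaled; for U of unit length at the point these are the formulas as printed. *)

(* Defs.v *)
From mathcomp Require Export all_boot all_order all_algebra.
From mathcomp Require Export all_classical all_reals all_analysis.
Export Order.TTheory GRing.Theory Num.Theory.
Export numFieldNormedType.Exports.

Set Implicit Arguments.
Unset Strict Implicit.
Unset Printing Implicit Defensive.

Local Open Scope classical_set_scope.
Local Open Scope ring_scope.

Section SmoothFunctions.
Context {R : realType} {V : normedModType R}.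

Fixpoint iter_deriv (s : seq V) (f : V -> R) : V -> R :=
  if s is v :: s' then 'D_v (iter_deriv s' f) else f.

(* [C^oo] on an open set [O] of a finite-dimensional space: all iterated
   directional derivatives exist and are continuous on [O].  Directional
   derivatives are local, so the values of [f] outside [O] are irrelevant. *)
Definition smooth_on (O : set V) (f : V -> R) : Prop :=
  forall (s : seq V) (x : V), O x ->
    {for x, continuous (iter_deriv s f)} /\
    forall v : V, derivable (iter_deriv s f) x v.

End SmoothFunctions.

(* The atlas is indexed by the points: [chart x] is a chart whose domain
   [dom x] contains [x], with inverse [ichart x].  The functions [chart x] and
   [ichart x] are total, but only their values on [dom x] and on
   [chart x @` dom x] are meaningful. *)
Record manifold (R : realType) (m : nat) := Manifold {
  carrier :> topologicalType;
  dom : carrier -> set carrier;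
  chart : carrier -> carrier -> 'rV[R]_m;
  ichart : carrier -> 'rV[R]_m -> carrier;
  dom_mem : forall x, dom x x;
  dom_open : forall x, open (dom x);
  img_open : forall x, open (chart x @` dom x);
  chartK : forall x y, dom x y -> ichart x (chart x y) = y;
  chart_continuous : forall x y, dom x y -> {for y, continuous (chart x)};
  ichart_continuous : forall x z, (chart x @` dom x) z ->
    {for z, continuous (ichart x)};
  transition_smooth : forall (x y : carrier) (j : 'I_m),
    smooth_on (chart x @` (dom x `&` dom y))
              (fun z => chart y (ichart x z) ord0 j);
  manifold_hausdorff : hausdorff_space carrier;
  manifold_second_countable : @second_countable carrier
}.

Section Manifold.
Context {R : realType} {m : nat} {M : manifold R m}.

Definition img (x : M) : set 'rV[R]_m := chart x @` dom x.

Definition coord (x : M) (j : 'I_m) : M -> R := fun y => chart x y ord0 j.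

Definition smooth_fun (f : M -> R) : Prop :=
  forall x : M, smooth_on (img x) (f \o ichart x).

(* The tangent space at [x] is ['rV[R]_m]: a tangent vector is given by its
   components in the chart [chart x] selected at [x].  [der x v f] is the
   derivative of [f] at [x] along the tangent vector [v]; it only depends on
   the germ of [f] at [x]. *)
Definition der (x : M) (v : 'rV[R]_m) (f : M -> R) : R :=
  'D_v (f \o ichart x) (chart x x).

(* The tangent vector at [y] whose components in the chart [chart x] are [u]. *)
Definition of_chart (x y : M) (u : 'rV[R]_m) : 'rV[R]_m :=
  \row_j 'D_u (coord y j \o ichart x) (chart x y).

Definition field : Type := M -> 'rV[R]_m.

Definition act (X : field) (f : M -> R) : M -> R := fun x => der x (X x) f.

(* [act X (coord x j)] is the [j]-th component of [X] in the chart [chart x]. *)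
Definition smooth_field (X : field) : Prop :=
  forall (x : M) (j : 'I_m),
    smooth_on (img x) (act X (coord x j) \o ichart x).

(* The component functions of [X t] are smooth in [(t, z)] jointly. *)
Definition smooth_field_family (I : set R) (X : R -> field) : Prop :=
  forall (x : M) (j : 'I_m),
    smooth_on [set s : R * 'rV[R]_m | I s.1 /\ img x s.2]
      (fun s => act (X s.1) (coord x j) (ichart x s.2)).

(* [[X, Y] f = X (Y f) - Y (X f)], applied to the coordinates selected at
   [x]. *)
Definition bracket (X Y : field) : field := fun x =>
  \row_j (act X (act Y (coord x j)) x - act Y (act X (coord x j)) x).

(* A field of bilinear forms: [g x] is the Gram matrix in the basis of the
   tangent space at [x] given by the chart [chart x]. *)
Definition form : Type := M -> 'M[R]_m.

Definition ip (g : form) (x : M) (v w : 'rV[R]_m) : R :=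
  (v *m g x *m w^T) ord0 ord0.

Definition ipf (g : form) (X Y : field) : M -> R := fun x => ip g x (X x) (Y x).

Definition smooth_form (g : form) : Prop :=
  forall (x : M) (u w : 'rV[R]_m),
    smooth_on (img x) (fun z =>
      let y := ichart x z in ip g y (of_chart x y u) (of_chart x y w)).

Definition smooth_form_family (I : set R) (g : R -> form) : Prop :=
  forall (x : M) (u w : 'rV[R]_m),
    smooth_on [set s : R * 'rV[R]_m | I s.1 /\ img x s.2] (fun s =>
      let y := ichart x s.2 in
      ip (g s.1) y (of_chart x y u) (of_chart x y w)).

Record riemannian_metric (g : form) : Prop := RiemannianMetric {
  metric_smooth : smooth_form g;
  metric_sym : forall x v w, ip g x v w = ip g x w v;
  metric_pos : forall x v, v != 0 -> 0 < ip g x v v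
}.

(* An orientation, given by an oriented atlas. *)
Definition oriented : Prop :=
  forall x y z : M, dom x z -> dom y z ->
    0 < \det ('J (chart y \o ichart x) (chart x z)).

Record levi_civita (g : form) (D : field -> field -> field) : Prop :=
  LeviCivita {
  lc_smooth : forall X Y, smooth_field X -> smooth_field Y ->
    smooth_field (D X Y);
  lc_addl : forall X X' Y,
    smooth_field X -> smooth_field X' -> smooth_field Y ->
    forall x, D (fun y => X y + X' y) Y x = D X Y x + D X' Y x;
  lc_scalel : forall f X Y,
    smooth_fun f -> smooth_field X -> smooth_field Y ->
    forall x, D (fun y => f y *: X y) Y x = f x *: D X Y x;
  lc_addr : forall X Y Y',
    smooth_field X -> smooth_field Y -> smooth_field Y' ->
    forall x, D X (fun y => Y y + Y' y) x = D X Y x + D X Y' x;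
  lc_leibniz : forall f X Y,
    smooth_fun f -> smooth_field X -> smooth_field Y ->
    forall x, D X (fun y => f y *: Y y) x = act X f x *: Y x + f x *: D X Y x;
  lc_torsion : forall X Y, smooth_field X -> smooth_field Y ->
    forall x, D X Y x - D Y X x = bracket X Y x;
  lc_metric : forall X Y Z,
    smooth_field X -> smooth_field Y -> smooth_field Z ->
    forall x, act X (ipf g Y Z) x = ipf g (D X Y) Z x + ipf g Y (D X Z) x
}.

Definition curvature (D : field -> field -> field) (X Y Z : field) : field :=
  fun x => D X (D Y Z) x - D Y (D X Z) x - D (bracket X Y) Z x.

(* Meaningful at the points where [X] and [Y] are linearly independent. *)
Definition sec (g : form) (D : field -> field -> field) (X Y : field) (x : M)
    : R :=
  ipf g (curvature D X Y Y) X x /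
    (ipf g X X x * ipf g Y Y x - ipf g X Y x ^+ 2).

Definition bounded_field (g : form) (X : field) : Prop :=
  exists C : R, forall x, ipf g X X x <= C.

(* [g (sharp g b x v, u) = b (v, u)] for all [u]. *)
Definition sharp (g b : form) (x : M) (v : 'rV[R]_m) : 'rV[R]_m :=
  xget 0 [set w | forall u, ip g x w u = ip b x v u].

(* The time derivatives are taken in a fixed tangent space. *)
Definition dt_form (g : R -> form) (t : R) : form :=
  fun x => derive1 (fun s => g s x) t.

Definition dt_field (X : R -> field) (t : R) : field :=
  fun x => derive1 (fun s => X s x) t.

End Manifold.

Arguments field {R m} M.
Arguments form {R m} M.
Arguments oriented {R m} M.

Section Submersion.
Context {R : realType} {m p : nat} {M : manifold R m} {N : manifold R p}.
Variable pi : M -> N.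

Definition smooth_map : Prop :=
  continuous pi /\
  forall (x : M) (y : N) (j : 'I_p),
    smooth_on (chart x @` (dom x `&` pi @^-1` dom y))
              (coord y j \o pi \o ichart x).

Definition dmap (x : M) (v : 'rV[R]_m) : 'rV[R]_p :=
  \row_j der x v (coord (pi x) j \o pi).

Definition vertical (x : M) (v : 'rV[R]_m) : Prop := dmap x v = 0.

Definition vertical_field (X : field M) : Prop := forall x, vertical x (X x).

Definition horizontal (g : form M) (x : M) (h : 'rV[R]_m) : Prop :=
  forall v, vertical x v -> ip g x h v = 0.

Definition hproj (g : form M) (x : M) (v : 'rV[R]_m) : 'rV[R]_m :=
  xget 0 [set h | horizontal g x h /\ vertical x (v - h)].

Definition hlift (g : form M) (W : field N) : field M := fun x =>
  xget 0 [set h | horizontal g x h /\ dmap x h = W (pi x)].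

Record riemannian_submersion (g : form M) (gN : form N) : Prop :=
  RiemannianSubmersion {
  rs_smooth : smooth_map;
  rs_submersion : forall (x : M) (w : 'rV[R]_p), exists v, dmap x v = w;
  rs_isometry : forall x v w, horizontal g x v -> horizontal g x w ->
    ip g x v w = ip gN (pi x) (dmap x v) (dmap x w)
}.

(* [Riem(M, V, g0)] *)
Definition riem_vertical (g0 g : form M) : Prop :=
  riemannian_metric g /\
  forall x v w, vertical x v -> vertical x w -> ip g x v w = ip g0 x v w.

(* The second fundamental form of the fibers vanishes; [D] is the Levi-Civita
   connection. *)
Definition totally_geodesic_fibers (D : field M -> field M -> field M) : Prop :=
  forall X Y, smooth_field X -> smooth_field Y ->
    vertical_field X -> vertical_field Y -> vertical_field (D X Y).

(* The fields tangent to the fibers are the vertical ones, and their brackets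
   restrict to the brackets on the fibers: this is [L_V h = 0] on every fiber,
   [h] being the metric that [g] induces on it. *)
Definition killing_on_fibers (g : form M) (V : field M) : Prop :=
  forall X Y, smooth_field X -> smooth_field Y ->
    vertical_field X -> vertical_field Y ->
    forall x, act V (ipf g X Y) x
              - ipf g (bracket V X) Y x - ipf g X (bracket V Y) x = 0.

End Submersion.

(* Main.v *)
Require Import Defs.
From mathcomp Require Import ring lra.

(* By [g_t(W_i^t, v) = 0] for vertical [v] and the formula for [B_t], the lifts
   satisfy [dW_i^t/dt = - V_i].  Hence the [t]-derivative of the Lie derivative
   of the fiber metric along [W_i^t] is minus its Lie derivative along the
   Killing field [V_i], so it vanishes and the fibers stay totally geodesic for
   every [g_t].  For totally geodesic fibers the antisymmetry of [A] gives
   [|U|^2 sec(W_i^t, U) = 1/4 sum_j g_t([W_i^t, W_j^t], U)^2], which is then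
   differentiated twice, using that brackets commute with [d/dt] and that
   [B_t(U, .)] vanishes on vertical vectors and equals
   [sum_k g_0(V_k, U) g_N(W_k, dpi .)] in general. *)

Set Implicit Arguments.
Unset Strict Implicit.
Unset Printing Implicit Defensive.

Local Open Scope classical_set_scope.
Local Open Scope ring_scope.

(** * Directional derivatives *)

Section DirectionalDerivatives.
Context {R : realType} {V : normedModType R}.
Implicit Types (f g : V -> R) (O : set V) (x y u v w : V).

(** A tangent vector at [x] is a row of components in the chart chosen at [x], so a field need not
    be continuous as a function of the point: values at different points are compared through [act]
    on the coordinates of one fixed chart. Smoothness is phrased by directional derivatives alone,
    so linearity in the direction, symmetry of second derivatives and the chain rule are derived
    from the mean value theorem. Symmetry serves twice: in space, to make [bracket] act as a
    commutator, and in time and space, to let brackets commute with [d/dt]. Joint smoothness of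
    [W_i^t] in time and position is not assumed; it comes from a matrix formula for the lift. As the
    [W_i] form a global orthonormal frame of [N], the [W_i^t] form a global horizontal frame, and
    all computations use global smooth fields. The curvature formula is derived from the axioms in
    [levi_civita], and multiplied by [|U|^2] because [U] may vanish at some points. The [1/4] is the
    square of the [1/2] relating [A] to the vertical part of the bracket. *)

Lemma is_deriveDf (f g : V -> R) x v (df dg : R) :
  is_derive x v f df -> is_derive x v g dg ->
  is_derive x v (fun y => f y + g y) (df + dg).
Proof. exact: is_deriveD. Qed.

Lemma is_deriveNf (f : V -> R) x v (df : R) :
  is_derive x v f df -> is_derive x v (fun y => - f y) (- df).
Proof. exact: is_deriveN. Qed.

Lemma is_deriveBf (f g : V -> R) x v (df dg : R) :
  is_derive x v f df -> is_derive x v g dg ->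
  is_derive x v (fun y => f y - g y) (df - dg).
Proof. exact: is_deriveB. Qed.

Lemma is_deriveMf (f g : V -> R) x v (df dg : R) :
  is_derive x v f df -> is_derive x v g dg ->
  is_derive x v (fun y => f y * g y) (df * g x + f x * dg).
Proof.
move=> hf hg; apply: (is_derive_eq (is_deriveM hf hg)).
by rewrite addrC /GRing.scale/= [g x * _]mulrC.
Qed.

Lemma is_deriveVf (f : V -> R) x v (df : R) : f x != 0 ->
  is_derive x v f df -> is_derive x v (fun y => (f y)^-1) (- (f x)^-1 ^+ 2 *
    df).
Proof.
move=> fx0 hf; split; first by apply: derivableV => //; exact: ex_derive.
by rewrite deriveV // derive_val exprVn.
Qed.

Lemma is_derive_sumf (I : Type) (r : seq I) (h : I -> V -> R) (dh : I ->
  R) x v :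
  (forall i, is_derive x v (h i) (dh i)) ->
  is_derive x v (fun y => \sum_(i <- r) h i y) (\sum_(i <- r) dh i).
Proof.
move=> H; elim: r => [|i r IH].
  rewrite big_nil; under eq_fun do rewrite big_nil; exact: is_derive_cst.
rewrite big_cons; under eq_fun do rewrite big_cons; exact: is_deriveDf.
Qed.

Lemma is_derive_line f (a v : V) (r : R) : derivable f (a + r *: v) v ->
  is_derive r 1 (fun s => f (a + s *: v)) ('D_v f (a + r *: v)).
Proof.
move=> df.
have E : (fun h => h^-1 *: (((fun s => f (a + s *: v)) \o shift r) (h *: 1) -
     f (a + r *: v))) =
     (fun h => h^-1 *: ((f \o shift (a + r *: v)) (h *: v) - f (a + r *: v))).
  apply/funext => h /=; congr (_ *: (f _ - _)).
  by rewrite [h *: 1]mulr1 scalerDl addrCA.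
split; first by rewrite /derivable E.
by rewrite /derive E.
Qed.

Lemma MVT_line f (a w : V) :
  (forall r : R, 0 <= r <= 1 -> derivable f (a + r *: w) w) ->
  exists2 c : R, 0 <= c <= 1 & f (a + w) - f a = 'D_w f (a + c *: w).
Proof.
move=> df.
have [||c /[!in_itv]/= /andP[c0 c1]] :=
    @MVT R (fun s => f (a + s *: w)) (fun s => 'D_w f (a + s *: w)) 0 1 ltr01.
- move=> r /[!in_itv]/= /andP[r0 r1]; apply: is_derive_line; apply: df.
  by rewrite !ltW.
- apply: derivable_within_continuous => r /[!in_itv]/= r01.
  have hr := df _ r01; exact: (@ex_derive _ _ _ _ _ _ _ (is_derive_line hr)).
rewrite scale1r scale0r addr0 subr0 mulr1 => ->.
by exists c => //; rewrite !ltW.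
Qed.

Lemma is_deriveZv f x v (k : R) : derivable f x v ->
  is_derive x (k *: v) f (k * 'D_v f x).
Proof.
move=> df; have df' : derivable f (x + 0 *: v) v by rewrite scale0r addr0.
have [dl el] := is_derive_line df'.
(* Composing with [h * k] treats [k = 0] like any other value; rescaling the difference quotient
   would divide by [k]. *)
have lin : is_derive (0 : R) 1 (fun h : R => h * k) k.
  apply: (is_derive_eq (is_deriveM (is_derive_id (0 : R) 1)
     (is_derive_cst k (0 : R) 1))).
  by rewrite scaler0 add0r [_%:A]mulr1.
have lin0 : (0 : R) * k = 0 by rewrite mul0r.
have dk : derivable (fun s : R => f (x + s *: v)) (0 * k) 1 by rewrite lin0.
have dk0 : derivable (fun h : R => h * k) 0 1 by exact: ex_derive.
have c1 : derivable ((fun s : R => f (x + s *: v)) \o (fun h : R => h * k)) 0 1.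
  apply/derivable1_diffP/differentiable_comp; apply/derivable1_diffP.
    exact: dk0.
  exact: dk.
have c2 := derive1_comp dk0 dk.
have E : ((fun s : R => f (x + s *: v)) \o (fun h : R => h * k)) =
     (fun h : R => f (h *: (k *: v) + x)).
  by apply/funext => h /=; rewrite addrC scalerA.
rewrite E in c1 c2.
split; first exact/derivable1P.
move: c2; rewrite !derive1E lin0 el scale0r addr0.
rewrite (@derive_val _ _ _ _ _ _ _ lin) mulrC => <-.
rewrite /derive; set F := (fun h => _); set G := (fun h : R => h^-1 *: _).
suff -> : F = G by [].
by apply/funext => h; rewrite /F /G /= addr0 scale0r add0r [h%:A]mulr1.
Qed.

Lemma derivable_line_cvg (W : normedModType R) (phi : V -> W) z v :
  derivable phi z v -> phi (h *: v + z) @[h --> (0 : R)] --> phi z.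
Proof.
move=> /derivable1P/derivable1_diffP/differentiable_continuous H.
have <- : phi (0 *: v + z) = phi z by rewrite scale0r add0r.
exact: H.
Qed.

(** Directional derivatives need not be additive in the direction. On the path through [x + h *: u]
    the second increment is, by the mean value theorem, governed by a value of ['D_v f] near [x];
    continuity of ['D_v f] at [x] gives the limit. *)
Lemma is_deriveDv O f x u v : open O -> O x -> derivable f x u ->
  (forall y, O y -> derivable f y v) -> {for x, continuous ('D_v f)} ->
  is_derive x (u + v) f ('D_u f x + 'D_v f x).
Proof.
move=> oO Ox du dv cv.
suff H : (fun h => h^-1 *: ((f \o shift x) (h *: (u + v)) - f x)) @ 0^' -->
    'D_u f x + 'D_v f x.
  by split; [apply/cvg_ex; eexists; exact: H | exact/cvg_lim].
have H1 : (fun h => h^-1 *: ((f \o shift x) (h *: u) - f x)) @ 0^' --> 'D_u f x.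
  exact: du.
suff H2 : (fun h : R => h^-1 *: (f (x + h *: u + h *: v) - f (x + h *: u))) @
  0^'
    --> 'D_v f x.
  rewrite (_ : (fun h => _) = (fun h => h^-1 *: ((f \o shift x) (h *: u) - f x)
     + h^-1 *: (f (x + h *: u + h *: v) - f (x + h *: u)))); last first.
    apply/funext => h /=; rewrite -scalerDr; congr (_ *: _).
    rewrite [h *: u + x]addrC [_ + x]addrC scalerDr addrA; ring.
  exact: (cvgD H1 H2).
apply/cvgrPdist_le => e e0.
move/cvgrPdist_le : (cv) => /(_ e e0) cve.
have nO : nbhs x O by exact: open_nbhs_nbhs.
have /nbhs_ballP[d /= d0 dB] : nbhs x (O `&` [set y | `|'D_v f x - 'D_v f y| <=
  e]).
  exact: filterI.
have small : \forall h \near (0 : R)^', `|h| * (`|u| + `|v|) < d.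
  (* The [+ 1] keeps the denominator positive when [u] and [v] both vanish. *)
  have D0 : 0 < d / (`|u| + `|v| + 1).
    by apply: divr_gt0 => //; rewrite ltr_wpDl // addr_ge0.
  near=> h.
  have : `|h| < d / (`|u| + `|v| + 1) by near: h; exact: dnbhs0_lt.
  rewrite ltr_pdivlMr ?ltr_wpDl ?addr_ge0 //; apply: le_lt_trans.
  by rewrite ler_wpM2l // lerDl.
near=> h.
have h0 : h != 0 by near: h; exact: nbhs_dnbhs_neq.
have hB (r : R) : 0 <= r <= 1 -> ball x d (x + h *: u + r *: (h *: v)).
  move=> /andP[r0 r1]; rewrite -ball_normE /ball_ /= -addrA opprD addNKr normrN.
  apply: le_lt_trans (ler_normD _ _) _; rewrite !normrZ (ger0_norm r0).
  have : `|h| * (`|u| + `|v|) < d by near: h.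
  apply: le_lt_trans; rewrite mulrDr lerD2l.
  by rewrite ler_piMl ?mulr_ge0.
have [r r01|c c01 ->] := @MVT_line f (x + h *: u) (h *: v).
  by case: (is_deriveZv h (dv _ (dB _ (hB _ r01)).1)).
have [Oc /= ec] := dB _ (hB _ c01).
rewrite (@derive_val _ _ _ _ _ _ _ (is_deriveZv h (dv _ Oc))).
by rewrite [_ *: _]mulKf.
Unshelve. all: by end_near. Qed.

(** Two uses of the mean value theorem: along [u] for [f (y + v) - f y], whose derivative is an
    increment of ['D_u f], then along [v] for that increment. *)
Lemma second_difference O f x u v :
  (forall a b : R, 0 <= a <= 1 -> 0 <= b <= 1 -> O (x + a *: u + b *: v)) ->
  (forall y, O y -> derivable f y u /\ derivable ('D_u f) y v) ->
  exists a b : R, [/\ 0 <= a <= 1, 0 <= b <= 1 &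
    f (x + u + v) - f (x + u) - (f (x + v) - f x) =
    'D_v ('D_u f) (x + a *: u + b *: v)].
Proof.
move=> hO hf.
pose F y := f (y + v) - f y.
have shiftD y : derivable f (y + v) u ->
    is_derive y u (fun y => f (y + v)) ('D_u f (y + v)).
  move=> df.
  have E : (fun h => h^-1 *: (((fun y => f (y + v)) \o shift y) (h *: u) -
       f (y + v))) =
       (fun h => h^-1 *: ((f \o shift (y + v)) (h *: u) - f (y + v))).
    by apply/funext => h /=; rewrite addrA.
  split; first by rewrite /derivable E.
  by rewrite /derive E.
have h1 : 0 <= (1 : R) <= 1 by rewrite ler01 lexx.
have h00 : 0 <= (0 : R) <= 1 by rewrite ler01 lexx.
have dF r : 0 <= r <= 1 -> is_derive (x + r *: u) u F
    ('D_u f (x + r *: u + v) - 'D_u f (x + r *: u)).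
  move=> r01; apply: is_deriveBf.
    by apply: shiftD; have := (hf _ (hO _ _ r01 h1)).1; rewrite scale1r.
  by apply: derivableP; have := (hf _ (hO _ _ r01 h00)).1;
    rewrite scale0r addr0.
have [r r01|a a01] := @MVT_line F x u; first by case: (dF _ r01).
rewrite (@derive_val _ _ _ _ _ _ _ (dF _ a01)) => E1.
have [r r01|b b01 E2] := @MVT_line ('D_u f) (x + a *: u) v.
  exact: (hf _ (hO _ _ a01 r01)).2.
by exists a, b; split => //; rewrite -E2 -E1.
Qed.

(** Schwarz's theorem. The second difference over a small parallelogram is symmetric in [u] and [v],
    so a value of ['D_v ('D_u f)] near [x] equals a value of ['D_u ('D_v f)] near [x]; each is
    within [e / 2] of its value at [x]. *)
Lemma derive_swap O f x u v : open O -> O x ->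
  (forall y, O y -> [/\ derivable f y u, derivable f y v,
     derivable ('D_u f) y v & derivable ('D_v f) y u]) ->
  {for x, continuous ('D_v ('D_u f))} -> {for x, continuous ('D_u ('D_v f))} ->
  'D_v ('D_u f) x = 'D_u ('D_v f) x.
Proof.
move=> oO Ox hf c1 c2.
apply/eqP; rewrite -subr_eq0 -normr_le0; apply/ler_addgt0Pr => e e0.
rewrite add0r; have e20 : 0 < e / 2 by rewrite divr_gt0.
move/cvgrPdist_le : (c1) => /(_ _ e20) cve.
move/cvgrPdist_le : (c2) => /(_ _ e20) cve2.
have nO : nbhs x O by exact: open_nbhs_nbhs.
have /nbhs_ballP[d /= d0 dB] : nbhs x (O `&` ([set y |
    `|'D_v ('D_u f) x - 'D_v ('D_u f) y| <= e / 2] `&`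
    [set y | `|'D_u ('D_v f) x - 'D_u ('D_v f) y| <= e / 2])).
  by apply: filterI nO _; exact: filterI cve cve2.
have D0 : 0 < `|u| + `|v| + 1 by rewrite ltr_wpDl // addr_ge0.
(* Scaling by this [h] keeps the whole parallelogram in the ball of radius [d]. *)
have [h h0 hd] : exists2 h : R, 0 < h & h * (`|u| + `|v| + 1) = d.
  by exists (d / (`|u| + `|v| + 1)); rewrite ?divr_gt0 // divfK // gt_eqF.
have hB (a b : R) : 0 <= a <= 1 -> 0 <= b <= 1 ->
    ball x d (x + a *: (h *: u) + b *: (h *: v)).
  move=> /andP[a0 a1] /andP[b0 b1].
  rewrite -ball_normE /ball_ /= -addrA opprD addNKr normrN.
  apply: le_lt_trans (ler_normD _ _) _.
  rewrite !normrZ (ger0_norm a0) (ger0_norm b0) (gtr0_norm h0).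
  rewrite -[ltRHS]hd -addrA mulrDr; apply: ler_ltD.
    by rewrite ler_piMl ?mulr_ge0 // ltW.
  apply: (@le_lt_trans _ _ (h * `|v|)); last by rewrite mulrDr mulr1 ltrDl.
  by rewrite ler_piMl ?mulr_ge0 // ltW.
have dZ g y w (k : R) : derivable g y w -> 'D_(k *: w) g y = k * 'D_w g y.
  by move=> dg; rewrite (@derive_val _ _ _ _ _ _ _ (is_deriveZv k dg)).
have dZ2 y : O y ->
   'D_(h *: v) ('D_(h *: u) f) y = h * (h * 'D_v ('D_u f) y) /\
   derivable ('D_(h *: u) f) y (h *: v).
  move=> Oy; have [d1 d2 d3 d4] := hf _ Oy.
  have E : \forall z \near y, h * 'D_u f z = 'D_(h *: u) f z.
    have : nbhs y O by exact: open_nbhs_nbhs.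
    by apply: filterS => z /hf[dz _ _ _]; rewrite dZ.
  have I : is_derive y v ('D_(h *: u) f) (h * 'D_v ('D_u f) y).
    apply: (near_eq_is_derive E).
    exact: (@is_deriveZ _ _ _ ('D_u f) h _ _ _ (derivableP d3)).
  have [I1 I2] := is_deriveZv h (@ex_derive _ _ _ _ _ _ _ I).
  by rewrite I2 (@derive_val _ _ _ _ _ _ _ I).
have dZ2' y : O y ->
   'D_(h *: u) ('D_(h *: v) f) y = h * (h * 'D_u ('D_v f) y) /\
   derivable ('D_(h *: v) f) y (h *: u).
  move=> Oy; have [d1 d2 d3 d4] := hf _ Oy.
  have E : \forall z \near y, h * 'D_v f z = 'D_(h *: v) f z.
    have : nbhs y O by exact: open_nbhs_nbhs.
    by apply: filterS => z /hf[_ dz _ _]; rewrite dZ.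
  have I : is_derive y u ('D_(h *: v) f) (h * 'D_u ('D_v f) y).
    apply: (near_eq_is_derive E).
    exact: (@is_deriveZ _ _ _ ('D_v f) h _ _ _ (derivableP d4)).
  have [I1 I2] := is_deriveZv h (@ex_derive _ _ _ _ _ _ _ I).
  by rewrite I2 (@derive_val _ _ _ _ _ _ _ I).
have [||a [b [a01 b01 E1]]] := @second_difference O f x (h *: u) (h *: v).
- by move=> a b a01 b01; case: (dB _ (hB _ _ a01 b01)).
- move=> y Oy; have [d1 _ _ _] := hf _ Oy; split; last by case: (dZ2 _ Oy).
  by case: (is_deriveZv h d1).
have [||a' [b' [a01' b01' E2]]] := @second_difference O f x (h *: v) (h *: u).
- move=> a' b' a01' b01'; rewrite addrAC.
  by case: (dB _ (hB _ _ b01' a01')).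
- move=> y Oy; have [_ d2 _ _] := hf _ Oy; split; last by case: (dZ2' _ Oy).
  by case: (is_deriveZv h d2).
have [Op [/= p1 _]] := dB _ (hB _ _ a01 b01).
have Bq : ball x d (x + a' *: (h *: v) + b' *: (h *: u)).
  by rewrite addrAC; exact: hB.
have [Oq [/= _ q1]] := dB _ Bq.
(* Both mean values express the same second difference, with the common factor [h * h]. *)
have E3 : 'D_v ('D_u f) (x + a *: (h *: u) + b *: (h *: v)) =
    'D_u ('D_v f) (x + a' *: (h *: v) + b' *: (h *: u)).
  move: E1 E2; rewrite (dZ2 _ Op).1 (dZ2' _ Oq).1 [x + h *: v + h *: u]addrAC =>
    E1 E2.
  have hn0 : h != 0 by rewrite gt_eqF.
  apply: (mulfI hn0); apply: (mulfI hn0); rewrite -[LHS]E1 -[RHS]E2.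
  by rewrite !opprB addrCA !addrA; ring.
rewrite -E3 in q1; rewrite -(subrKA ('D_v ('D_u f) (x + a *: (h *: u) + b *: (h
  *: v)))).
apply: (le_trans (ler_normD _ _)); rewrite (splitr e); apply: lerD p1 _.
by rewrite distrC.
Qed.

End DirectionalDerivatives.

(** * Smooth functions on open sets *)

Section Smooth.
Context {R : realType} {V : normedModType R}.
Implicit Types (f g : V -> R) (O : set V) (x y u v w : V).

(* Unlike in [iter_deriv], the innermost derivative is peeled off first: the
   Leibniz and chain rules then allow inductions on [k]. *)
Fixpoint Ck (k : nat) O f : Prop :=
  (forall x, O x -> {for x, continuous f}) /\
  if k is k'.+1 then forall v, (forall x, O x -> derivable f x v) /\
                               Ck k' O ('D_v f)
  else True.

Lemma Ck_continuous k O f x : Ck k O f -> O x -> {for x, continuous f}.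
Proof. by case: k => [|k] [H _]; exact: H. Qed.

Lemma Ck_derivable k O f x v : Ck k.+1 O f -> O x -> derivable f x v.
Proof. by move=> [_ /(_ v) [H _]]; exact: H. Qed.

Lemma Ck_derive k O f v : Ck k.+1 O f -> Ck k O ('D_v f).
Proof. by move=> [_ /(_ v) [_ H]]. Qed.

(** [iter_deriv] applies the head of its list last, so the innermost derivative is the last entry:
    hence [rcons] here and induction from the end of the list in [smooth_onP]. *)
Lemma smooth_onS O f v : smooth_on O f -> smooth_on O ('D_v f).
Proof.
move=> hf s x Ox; have := hf (rcons s v) x Ox.
suff -> : iter_deriv (rcons s v) f = iter_deriv s ('D_v f) by [].
by elim: s {hf x Ox} => //= w s ->.
Qed.

Lemma smooth_onP O f : smooth_on O f <-> forall k, Ck k O f.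
Proof.
split=> [hf k|].
  elim: k f hf => [|k IH] f hf; first by split=> // x Ox; case: (hf [::] x Ox).
  split=> [x Ox|v]; first by case: (hf [::] x Ox).
  split=> [x Ox|]; first by case: (hf [::] x Ox).
  exact/IH/smooth_onS.
move=> hf s; elim/last_ind: s f hf => [|s v IH] f hf x Ox.
  by split=> [|v]; [exact: Ck_continuous (hf 0%N) Ox | exact: Ck_derivable (hf
    1%N) Ox].
have -> : iter_deriv (rcons s v) f = iter_deriv s ('D_v f).
  by elim: s {IH} => //= w s ->.
by apply: IH => // k; exact: Ck_derive (hf k.+1).
Qed.

Lemma smooth_on_continuous O f x : smooth_on O f -> O x ->
  {for x, continuous f}.
Proof. by move=> hf Ox; case: (hf [::] x Ox). Qed.

Lemma smooth_on_derivable O f x v : smooth_on O f -> O x -> derivable f x v.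
Proof. by move=> hf Ox; case: (hf [::] x Ox). Qed.

Lemma smooth_on_sub O O' f : O' `<=` O -> smooth_on O f -> smooth_on O' f.
Proof. by move=> sO hf s x /sO; exact: hf. Qed.

Lemma smooth_on_local O f :
  (forall x, O x -> exists2 O' : set V, O' x & smooth_on O' f) -> smooth_on O f.
Proof. by move=> hf s x /hf [D Dx h]; exact: h. Qed.

(** On an open set, equal values mean equal germs at every point, and derivatives depend only on
    germs. *)
Lemma Ck_ext k O f g : open O -> (forall x, O x -> f x = g x) ->
  Ck k O f -> Ck k O g.
Proof.
move=> oO; elim: k f g => [|k IH] f g fg hf.
all: have nfg x : O x -> \forall y \near x, f y = g y
  by move=> Ox; have : nbhs x O by [exact: open_nbhs_nbhs]; exact: filterS.
all: have cg x : O x -> {for x, continuous g}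
  by move=> Ox; have cf := Ck_continuous hf Ox;
    rewrite /prop_for /continuous_at;
     rewrite -(fg _ Ox); apply: cvg_trans cf; apply: near_eq_cvg;
     apply: filterS (nfg _ Ox) => y ->.
  by split.
split=> // v; split=> [x Ox|].
  by apply: near_eq_derivable (nfg _ Ox) _; exact: Ck_derivable hf Ox.
apply: (IH ('D_v f)); last exact: Ck_derive.
by move=> x Ox; apply: near_eq_derive; exact: nfg.
Qed.

Lemma smooth_on_ext O f g : open O -> (forall x, O x -> f x = g x) ->
  smooth_on O f -> smooth_on O g.
Proof.
by move=> oO fg /smooth_onP hf; apply/smooth_onP => k; exact: Ck_ext (hf k).
Qed.

Lemma CkW k O f : Ck k.+1 O f -> Ck k O f.
Proof.
elim: k f => [|k IH] f hf.
  by split=> // x; exact: Ck_continuous hf.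
split=> [x|v]; first exact: Ck_continuous hf.
split=> [x|]; first exact: Ck_derivable hf.
by apply: IH; exact: Ck_derive.
Qed.

Lemma Ck_cst k O (c : R) : Ck k O (fun=> c).
Proof.
elim: k c => [|k IH] c; first by split=> // x _; exact: cvg_cst.
split=> [x _|v]; first exact: cvg_cst.
split=> [x _|]; first exact: derivable_cst.
have -> : 'D_v (fun=> c) = (fun=> 0) :> (V -> R).
  by apply/funext => x; exact: derive_cst.
exact: IH.
Qed.

Lemma CkD k O f g : open O -> Ck k O f -> Ck k O g ->
  Ck k O (fun x => f x + g x).
Proof.
move=> oO; elim: k f g => [|k IH] f g hf hg.
  split=> // x Ox.
  exact: continuousD (Ck_continuous hf Ox) (Ck_continuous hg Ox).
split=> [x Ox|v].
  exact: continuousD (Ck_continuous hf Ox) (Ck_continuous hg Ox).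
have d x (Ox : O x) := is_deriveDf (derivableP (Ck_derivable (v := v) hf Ox))
  (derivableP (Ck_derivable (v := v) hg Ox)).
split=> [x Ox|]; first by case: (d _ Ox).
apply: (@Ck_ext _ _ (fun x => 'D_v f x + 'D_v g x)) => //.
  by move=> x Ox; case: (d _ Ox).
by apply: IH; exact: Ck_derive.
Qed.

Lemma CkM k O f g : open O -> Ck k O f -> Ck k O g ->
  Ck k O (fun x => f x * g x).
Proof.
move=> oO; elim: k f g => [|k IH] f g hf hg.
  split=> // x Ox.
  exact: continuousM (Ck_continuous hf Ox) (Ck_continuous hg Ox).
split=> [x Ox|v].
  exact: continuousM (Ck_continuous hf Ox) (Ck_continuous hg Ox).
have d x (Ox : O x) := is_deriveMf (derivableP (Ck_derivable (v := v) hf Ox))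
  (derivableP (Ck_derivable (v := v) hg Ox)).
split=> [x Ox|]; first by case: (d _ Ox).
apply: (@Ck_ext _ _ (fun x => 'D_v f x * g x + f x * 'D_v g x)) => //.
  by move=> x Ox; case: (d _ Ox).
by apply: CkD => //; apply: IH; (exact: CkW || exact: Ck_derive).
Qed.

Lemma CkN k O f : open O -> Ck k O f -> Ck k O (fun x => - f x).
Proof.
move=> oO hf; apply: (@Ck_ext _ _ (fun x => -1 * f x)) => //.
  by move=> x _; rewrite mulN1r.
by apply: CkM => //; exact: Ck_cst.
Qed.

Lemma CkV k O f : open O -> (forall x, O x -> f x != 0) ->
  Ck k O f -> Ck k O (fun x => (f x)^-1).
Proof.
move=> oO f0; elim: k => [|k IH] hf.
  by split=> // x Ox; apply: cvgV; [exact: f0 | exact: Ck_continuous hf Ox].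
split=> [x Ox|v].
  by apply: cvgV; [exact: f0 | exact: Ck_continuous hf Ox].
have d x (Ox : O x) := is_deriveVf (f0 _ Ox) (derivableP (Ck_derivable (v :=
  v) hf Ox)).
split=> [x Ox|]; first by case: (d _ Ox).
apply: (@Ck_ext _ _ (fun x => - ((f x)^-1 * (f x)^-1) * 'D_v f x)) => //.
  by move=> x Ox; case: (d _ Ox) => _ ->.
apply: CkM => //; last exact: Ck_derive.
by apply: CkN => //; apply: CkM => //; apply: IH; exact: CkW.
Qed.

Lemma smooth_onD O f g : open O -> smooth_on O f -> smooth_on O g ->
  smooth_on O (fun x => f x + g x).
Proof.
by move=> oO /smooth_onP hf /smooth_onP hg; apply/smooth_onP => k; exact: CkD.
Qed.

Lemma smooth_onM O f g : open O -> smooth_on O f -> smooth_on O g ->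
  smooth_on O (fun x => f x * g x).
Proof.
by move=> oO /smooth_onP hf /smooth_onP hg; apply/smooth_onP => k; exact: CkM.
Qed.

Lemma smooth_onN O f : open O -> smooth_on O f -> smooth_on O (fun x => - f x).
Proof. by move=> oO /smooth_onP hf; apply/smooth_onP => k; exact: CkN. Qed.

Lemma smooth_onV O f : open O -> (forall x, O x -> f x != 0) ->
  smooth_on O f -> smooth_on O (fun x => (f x)^-1).
Proof. by move=> oO f0 /smooth_onP hf; apply/smooth_onP => k; exact: CkV. Qed.

Lemma smooth_on_cst O (c : R) : smooth_on O (fun=> c).
Proof. by apply/smooth_onP => k; exact: Ck_cst. Qed.

Lemma smooth_on_sum O (I : Type) (r : seq I) (F : I -> V -> R) : open O ->
  (forall i, smooth_on O (F i)) -> smooth_on O (fun x => \sum_(i <- r) F i x).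
Proof.
move=> oO hF; elim: r => [|i r IH].
  under eq_fun do rewrite big_nil; exact: smooth_on_cst.
under eq_fun do rewrite big_cons; exact: (smooth_onD oO (hF i) IH).
Qed.

Lemma smooth_on_prod O (I : Type) (r : seq I) (F : I -> V -> R) : open O ->
  (forall i, smooth_on O (F i)) -> smooth_on O (fun x => \prod_(i <- r) F i x).
Proof.
move=> oO hF; elim: r => [|i r IH].
  under eq_fun do rewrite big_nil; exact: smooth_on_cst.
under eq_fun do rewrite big_cons; exact: (smooth_onM oO (hF i) IH).
Qed.

Lemma smooth_on_is_deriveDv O f x u v : open O -> O x -> smooth_on O f ->
  is_derive x (u + v) f ('D_u f x + 'D_v f x).
Proof.
move=> oO Ox hf; apply: (is_deriveDv oO) => //.
- exact: smooth_on_derivable hf Ox.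
- by move=> y; exact: smooth_on_derivable hf.
- exact: smooth_on_continuous (smooth_onS v hf) Ox.
Qed.

Lemma smooth_on_deriveDv O f x u v : open O -> O x -> smooth_on O f ->
  'D_(u + v) f x = 'D_u f x + 'D_v f x.
Proof. by move=> oO Ox hf; case: (smooth_on_is_deriveDv u v oO Ox hf). Qed.

Lemma smooth_on_deriveZv O f x v (k : R) : O x -> smooth_on O f ->
  'D_(k *: v) f x = k * 'D_v f x.
Proof.
by move=> Ox hf; case: (is_deriveZv k (smooth_on_derivable (v := v) hf Ox)).
Qed.

Lemma smooth_on_derive_sumv O f x (I : Type) (r : seq I) (F : I -> V) :
  open O -> O x -> smooth_on O f ->
  'D_(\sum_(i <- r) F i) f x = \sum_(i <- r) 'D_(F i) f x.
Proof.
move=> oO Ox hf; elim: r => [|i r IH]; first by rewrite !big_nil derive0.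
by rewrite !big_cons (smooth_on_deriveDv _ _ oO) // IH.
Qed.

Lemma smooth_on_derive_swap O f x u v : open O -> O x -> smooth_on O f ->
  'D_u ('D_v f) x = 'D_v ('D_u f) x.
Proof.
move=> oO Ox hf; apply: (derive_swap oO Ox).
- move=> y Oy; split; first exact: (smooth_on_derivable hf Oy).
  + exact: (smooth_on_derivable hf Oy).
  + exact: (smooth_on_derivable (smooth_onS _ hf) Oy).
  + exact: (smooth_on_derivable (smooth_onS _ hf) Oy).
- by apply: smooth_on_continuous Ox; do 2!apply: smooth_onS.
- by apply: smooth_on_continuous Ox; do 2!apply: smooth_onS.
Qed.

End Smooth.

(** * Chain rule for maps into coordinate space *)

Section ChainRule.
Context {R : realType} {V : normedModType R} {m : nat}.
Implicit Types (F : 'rV[R]_m -> R) (phi : V -> 'rV[R]_m) (O : set 'rV[R]_m).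

Lemma derive_rowE O F (x w : 'rV[R]_m) : open O -> O x -> smooth_on O F ->
  'D_w F x = \sum_k w ord0 k * 'D_(delta_mx 0 k) F x.
Proof.
move=> oO Ox hF; rewrite {1}[w]row_sum_delta (smooth_on_derive_sumv _ _ oO) //.
by apply: eq_bigr => k _; rewrite (smooth_on_deriveZv _ _ Ox).
Qed.

(** With [w h] the increment of [phi], the increment of [F] is a derivative along [w h] at a point
    of the segment from [phi z]. Expanded in the standard basis and divided by [h], it converges
    because the partial derivatives of [F] are continuous. *)
Lemma is_derive_chain O F phi (z v : V) : open O -> O (phi z) ->
  smooth_on O F ->
  derivable phi z v ->
  is_derive z v (F \o phi) ('D_('D_v phi z) F (phi z)).
Proof.
move=> oO Oz hF dphi.
pose w (h : R) : 'rV[R]_m := phi (h *: v + z) - phi z.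
have w0 : w h @[h --> (0 : R)] --> (0 : 'rV[R]_m).
  rewrite -(subrr (phi z)); apply: cvgB; last exact: cvg_cst.
  exact: derivable_line_cvg.
have nO : nbhs (phi z) O by exact: open_nbhs_nbhs.
have /nbhs_ballP[d /= d0 dB] := nO.
have ballw (h c : R) : `|w h| < d -> 0 <= c <= 1 ->
  ball (phi z) d (phi z + c *: w h).
  move=> wd /andP[c0 c1]; rewrite -ball_normE /ball_ /= opprD addNKr normrN.
  by rewrite normrZ (ger0_norm c0) (le_lt_trans _ wd) // ler_piMl.
(* Where [w h] is too long for the mean value theorem, [c h] defaults to [0]; the bound
   [0 <= c h <= 1] then holds for all [h], and [c h *: w h] tends to [0]. *)
have /choice[c hc] : forall h : R, exists c : R, 0 <= c <= 1 /\
    (`|w h| < d -> F (phi z + w h) - F (phi z) = 'D_(w h) F (phi z + c *: w h)).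
  move=> h; have [wd|wd] := boolP (`|w h| < d); last first.
    by exists 0; rewrite lexx ler01; split.
  have [c' c'01|c c01 ->] := @MVT_line R _ F (phi z) (w h).
    exact: (smooth_on_derivable hF) (dB _ (ballw _ _ wd c'01)).
  by exists c.
have cw : phi z + c h *: w h @[h --> (0 : R)] --> phi z.
  rewrite -[X in _ --> X]addr0; apply: cvgD; first exact: cvg_cst.
  apply/cvgr0Pnorm_le => e e0.
  have := w0 => /cvgr0Pnorm_le/(_ _ e0); apply: filterS => h.
  have [/andP[c0 c1] _] := hc h; rewrite normrZ (ger0_norm c0).
  by apply: le_trans; rewrite ler_piMl.
have near_w : \forall h \near (0 : R)^', `|w h| < d.
  by apply: nbhs_dnbhs; move/cvgr0Pnorm_lt : w0 => /(_ _ d0).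
suff H : (fun h : R => h^-1 *: (((F \o phi) \o shift z) (h *: v) - (F \o phi)
  z))
    @ 0^' --> \sum_k ('D_v phi z) ord0 k * 'D_(delta_mx 0 k) F (phi z).
  rewrite (derive_rowE _ oO Oz hF).
  by split; [apply/cvg_ex; eexists; exact: H | exact/cvg_lim].
have L : (\sum_k (h^-1 *: w h) ord0 k * 'D_(delta_mx 0 k) F (phi z + c h *: w
  h))
    @[h --> (0 : R)^'] --> \sum_k ('D_v phi z) ord0 k * 'D_(delta_mx 0 k) F (phi
      z).
  apply: cvg_big => [|k _]; [exact: add_continuous|apply: cvgM].
    apply: (@cvg_comp _ _ _ (fun h => h^-1 *: w h) (fun M : 'rV[R]_m => M ord0
      k)).
      exact: dphi.
    exact: coord_continuous.
  apply: (@cvg_comp _ _ _ (fun h => phi z + c h *: w h) ('D_(delta_mx 0 k) F)).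
    exact: cvg_within_filter cw.
  exact: smooth_on_continuous (smooth_onS _ hF) Oz.
apply: cvg_trans L; apply: near_eq_cvg.
apply: filterS near_w => h wd.
have [c01 /(_ wd) E] := hc h.
have -> : ((F \o phi) \o shift z) (h *: v) - (F \o phi) z = F (phi z + w h) - F
  (phi z).
  by rewrite /= /w [phi z + _]addrC subrK.
rewrite E (derive_rowE _ oO (dB _ (ballw _ _ wd c01)) hF) scaler_sumr.
by apply: eq_bigr => k _; rewrite mxE -mulrA.
Qed.

Lemma derivable_row phi (z v : V) :
  (forall j, derivable (fun y => phi y ord0 j) z v) -> derivable phi z v.
Proof. by move=> H; apply/derivable_mxP => i j; rewrite (ord1 i). Qed.

Lemma derive_row phi (z v : V) : derivable phi z v ->
  'D_v phi z = \row_j 'D_v (fun y => phi y ord0 j) z.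
Proof. by move=> H; rewrite derive_mx //; apply/rowP => j; rewrite !mxE. Qed.

(** The derivative is a sum of products of derivatives of components of [phi] with partial
    derivatives of [F] composed with [phi]. The induction therefore varies [F] and fixes [phi]. *)
Lemma Ck_chain k (O' : set V) O F phi : open O' -> open O ->
  (forall z, O' z -> O (phi z)) -> smooth_on O F ->
  (forall j, smooth_on O' (fun z => phi z ord0 j)) -> Ck k O' (F \o phi).
Proof.
move=> oO' oO sO + hphi.
have dphi z v : O' z -> derivable phi z v.
  by move=> O'z; apply: derivable_row => j;
    exact: smooth_on_derivable (hphi j) O'z.
have cphi z : O' z -> {for z, continuous phi}.
  move=> O'z; apply/cvgrPdist_le => e e0.
  near=> y; rewrite /Num.Def.normr/= mx_normrE (bigmax_le _ (ltW e0))//= => -[i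
    j] _.
  rewrite !mxE/= (ord1 i); move: j; near: y; apply: filter_forall => j.
  by have /cvgrPdist_le := smooth_on_continuous (hphi j) O'z; apply.
elim: k F => [|k IH] F hF.
  split=> // z O'z; apply: continuous_comp; first exact: cphi.
  exact: smooth_on_continuous hF (sO _ O'z).
split=> [z O'z|v].
  apply: continuous_comp; first exact: cphi.
  exact: smooth_on_continuous hF (sO _ O'z).
have d z (O'z : O' z) := is_derive_chain oO (sO _ O'z) hF (dphi z v O'z).
split=> [z O'z|]; first by case: (d _ O'z).
apply: (@Ck_ext _ _ _ _ (fun z => \sum_j 'D_v (fun y => phi y ord0 j) z *
    ('D_(delta_mx 0 j) F \o phi) z)) => //.
  move=> z O'z; case: (d _ O'z) => _ ->.
  rewrite (derive_rowE _ oO (sO _ O'z) hF); apply: eq_bigr => j _.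
  by rewrite (derive_row (dphi _ _ O'z)) mxE.
elim: (index_enum _) => [|j r IHr].
  under eq_fun do rewrite big_nil; exact: Ck_cst.
under eq_fun do rewrite big_cons; apply: CkD => //; apply: CkM => //.
  by have /smooth_onP/(_ k) := smooth_onS v (hphi j).
by apply: IH; exact: smooth_onS.
Unshelve. all: by end_near. Qed.

Lemma smooth_on_chain (O' : set V) O F phi : open O' -> open O ->
  (forall z, O' z -> O (phi z)) -> smooth_on O F ->
  (forall j, smooth_on O' (fun z => phi z ord0 j)) -> smooth_on O' (F \o phi).
Proof. by move=> *; apply/smooth_onP => k; exact: (@Ck_chain _ _ O). Qed.

Lemma derive_chain O F phi (z v : V) : open O -> O (phi z) -> smooth_on O F ->
  (forall j, derivable (fun y => phi y ord0 j) z v) ->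
  'D_v (F \o phi) z = 'D_(\row_j 'D_v (fun y => phi y ord0 j) z) F (phi z).
Proof.
move=> oO Oz hF /derivable_row dphi;
  have [_ ->] := is_derive_chain oO Oz hF dphi.
by rewrite derive_row.
Qed.

End ChainRule.

(** * Functions of time and position *)

Section TimeSpace.
Context {R : realType} {V : normedModType R}.
Implicit Types (I : set R) (O : set V).

Definition box I O : set (R * V) := [set s | I s.1 /\ O s.2].

Lemma open_box I O : open I -> open O -> open (box I O).
Proof.
move=> oI oO.
have -> : box I O = (fst @^-1` I) `&` (snd @^-1` O) by [].
apply: openI; apply: open_comp => // s _; [exact: cvg_fst|exact: cvg_snd].
Qed.

Lemma Ck_slice k I O (F : R * V -> R) (t : R) : I t -> Ck k (box I O) F ->
  Ck k O (fun z => F (t, z)).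
Proof.
move=> It; have cpair z : {for z, continuous (fun z : V => (t, z))}.
  by apply: (@cvg_pair _ _ _ _ (nbhs t)); [exact: cvg_cst|exact: cvg_id].
elim: k F => [|k IH] F hF.
  split=> // z Oz; apply: (continuous_comp (f := fun z : V => (t, z))) => //.
  exact: Ck_continuous hF _.
split=> [z Oz|v].
  apply: (continuous_comp (f := fun z : V => (t, z))) => //.
  exact: Ck_continuous hF _.
have E z : (fun h : R => h^-1 *: (((fun z => F (t,
  z)) \o shift z) (h *: v) - F (t, z)))
    = (fun h : R => h^-1 *: ((F \o shift (t, z)) (h *: ((0 : R), v)) - F (t,
      z))).
  apply/funext => h /=; congr (_ *: (F _ - _)).
  by rewrite -[(t, z)]/((t, z) : R * V); congr pair; rewrite /= scaler0 add0r.
split=> [z Oz|].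
  have B : box I O (t, z) by split.
  have := Ck_derivable (v := ((0 : R), v)) hF B; rewrite /derivable -E; exact.
have -> : 'D_v (fun z => F (t, z)) = (fun z => 'D_((0 : R), v) F (t, z)).
  by apply/funext => z; rewrite /derive E.
exact: (IH ('D_((0 : R), v) F)) (Ck_derive _ hF).
Qed.

Lemma smooth_on_slice I O (F : R * V -> R) (t : R) : I t ->
  smooth_on (box I O) F -> smooth_on O (fun z => F (t, z)).
Proof.
by move=> It /smooth_onP hF; apply/smooth_onP => k; exact: (Ck_slice It (hF k)).
Qed.

Lemma derive_slice (F : R * V -> R) t z (v : V) :
  'D_v (fun z => F (t, z)) z = 'D_((0 : R), v) F (t, z).
Proof.
rewrite /derive; set G := (fun h => _);
  set H := (fun h : R => _ *: (_ _ - F (t, z))).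
suff -> : G = H by [].
apply/funext => h; rewrite /G /H /=; congr (_ *: (F _ - _)).
by congr pair; rewrite /= scaler0 add0r.
Qed.

Lemma is_derive_time (F : R * V -> R) t z :
  derivable F (t, z) ((1 : R), (0 : V)) ->
  is_derive t 1 (fun s => F (s, z)) ('D_((1 : R), (0 : V)) F (t, z)).
Proof.
have E : (fun h : R => h^-1 *: (((fun s => F (s,
  z)) \o shift t) (h *: 1) - F (t, z)))
    = (fun h : R => h^-1 *: ((F \o shift (t, z)) (h *: ((1 : R),
      (0 : V))) - F (t, z))).
  apply/funext => h /=; congr (_ *: (F _ - _)).
  by congr pair; rewrite /= scaler0 add0r.
move=> dF; split; first by rewrite /derivable E.
by rewrite /derive E.
Qed.

Lemma Ck_snd k (I : set R) O (f : V -> R) : Ck k O f ->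
  Ck k (box I O) (fun s => f s.2).
Proof.
have csnd (s : R * V) : {for s, continuous (snd : R * V ->
  V)} by exact: cvg_snd.
elim: k f => [|k IH] f hf.
  split=> // s [_ Os]; apply: continuous_comp => //; exact: Ck_continuous hf Os.
split=> [s [_ Os]|v].
  apply: continuous_comp => //; exact: Ck_continuous hf Os.
have E (s : R * V) :
   (fun h : R => h^-1 *: (((fun s : R * V => f s.2) \o shift s) (h *: v) - f
     s.2)) =
   (fun h : R => h^-1 *: ((f \o shift s.2) (h *: v.2) - f s.2)) by [].
split=> [s [_ Os]|].
  rewrite /derivable E; exact: (Ck_derivable (v := v.2) hf Os).
have -> : 'D_v (fun s : R * V => f s.2) = (fun s => 'D_(v.2) f s.2).
  by apply/funext => s; rewrite /derive E.
exact: (IH ('D_(v.2) f)) (Ck_derive _ hf).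
Qed.

Lemma smooth_on_snd (I : set R) O (f : V -> R) : smooth_on O f ->
  smooth_on (box I O) (fun s => f s.2).
Proof.
by move=> /smooth_onP hf; apply/smooth_onP => k; exact: Ck_snd.
Qed.

End TimeSpace.

(** * Smooth matrix-valued functions *)

Section SmoothMatrix.
Context {R : realType} {V : normedModType R}.
Variable O : set V.
Hypothesis oO : open O.

Definition smooth_mx m n (A : V -> 'M[R]_(m, n)) :=
  forall i j, smooth_on O (fun x => A x i j).

Lemma smooth_mxM m n p (A : V -> 'M[R]_(m, n)) (B : V -> 'M[R]_(n, p)) :
  smooth_mx A -> smooth_mx B -> smooth_mx (fun x => A x *m B x).
Proof.
move=> hA hB i j; under eq_fun do rewrite mxE.
by apply: smooth_on_sum => // k; exact: smooth_onM.
Qed.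

Lemma smooth_mxT m n (A : V -> 'M[R]_(m, n)) :
  smooth_mx A -> smooth_mx (fun x => (A x)^T).
Proof. by move=> hA i j; under eq_fun do rewrite mxE; exact: hA. Qed.

Lemma smooth_det n (A : V -> 'M[R]_n) :
  smooth_mx A -> smooth_on O (fun x => \det (A x)).
Proof.
move=> hA; apply: smooth_on_sum => // s; apply: smooth_onM => //.
  exact: smooth_on_cst.
exact: smooth_on_prod.
Qed.

Lemma smooth_invmx n (A : V -> 'M[R]_n) : (forall x, O x -> A x \in unitmx) ->
  smooth_mx A -> smooth_mx (fun x => invmx (A x)).
Proof.
move=> uA hA i j.
(* The cofactor formula exhibits the inverse as a rational function of the entries. *)
apply: (@smooth_on_ext _ _ _ (fun x => (\det (A x))^-1 *
   ((-1) ^+ (j + i) * \det (row' j (col' i (A x)))))) => //.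
  by move=> x Ox; rewrite /invmx uA // !mxE.
apply: smooth_onM => //.
  apply: smooth_onV => //; last exact: smooth_det.
  by move=> x /uA; rewrite unitmxE unitfE.
apply: smooth_onM => //; first exact: smooth_on_cst.
by apply: smooth_det => a b; under eq_fun do rewrite !mxE; exact: hA.
Qed.

End SmoothMatrix.

(** * Charts and tangent vectors *)

Section Charts.
Context {R : realType} {m : nat} {M : manifold R m}.
Implicit Types (x y w : M) (f g : M -> R) (u v : 'rV[R]_m).

Lemma ichart_dom x z : img x z -> dom x (ichart x z).
Proof. by move=> [y xy <-]; rewrite chartK. Qed.

Lemma ichartK x z : img x z -> chart x (ichart x z) = z.
Proof. by move=> [y xy <-]; rewrite chartK. Qed.

Lemma img_chart x y : dom x y -> img x (chart x y).
Proof. by move=> xy; exists y. Qed.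

Lemma img_self x : img x (chart x x).
Proof. exact/img_chart/dom_mem. Qed.

Lemma ichart_chart_self x : ichart x (chart x x) = x.
Proof. exact/chartK/dom_mem. Qed.

(** A preimage under [ichart x], so that openness follows from continuity; [image_dom_preim]
    identifies it with the chart image used in [transition_smooth] and [smooth_map]. *)
Definition preim x (A : set M) : set 'rV[R]_m := img x `&` ichart x @^-1` A.

Lemma open_preim x A : open A -> open (preim x A).
Proof.
move=> oA; rewrite openE => z [xz Az]; apply: filterI.
  by apply: open_nbhs_nbhs; split=> //; exact: img_open.
by apply: (@ichart_continuous _ _ _ x z) => //; exact: open_nbhs_nbhs.
Qed.

Lemma image_dom_preim x A : chart x @` (dom x `&` A) = preim x A.
Proof.
apply/seteqP; split=> [_ [y [xy Ay] <-]|_ [[y xy <-]]].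
  by split; [exact: img_chart | rewrite /= chartK].
by rewrite /= chartK // => Ay; exists y.
Qed.

Lemma open_dom_chart x (D : set 'rV[R]_m) : open D ->
  open (dom x `&` chart x @^-1` D).
Proof.
move=> oO; rewrite openE => y [xy Oy]; apply: filterI.
  by apply: open_nbhs_nbhs; split=> //; exact: dom_open.
by apply: (@chart_continuous _ _ _ x y) => //; exact: open_nbhs_nbhs.
Qed.

Lemma smooth_transition x y (j : 'I_m) :
  smooth_on (preim x (dom y)) (coord y j \o ichart x).
Proof. by rewrite -image_dom_preim; exact: transition_smooth. Qed.

(** A local notion is needed because [coord x j] is meaningful only on [dom x]. One chart around [w]
    suffices; [smooth_atP] passes to any other through the transition map. *)
Definition smooth_at f w : Prop := exists x, exists D : set 'rV[R]_m,
  [/\ open D, D `<=` img x, dom x w,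
    D (chart x w) & smooth_on D (f \o ichart x)].

Lemma smooth_atP f w x : smooth_at f w -> dom x w ->
  exists D : set 'rV[R]_m,
    [/\ open D, D `<=` img x, D (chart x w) & smooth_on D (f \o ichart x)].
Proof.
move=> [x0 [D0 [oO0 O0x0 x0w O0w hf]]] xw.
exists (preim x (dom x0 `&` chart x0 @^-1` D0)).
have oP : open (preim x (dom x0 `&` chart x0 @^-1` D0)).
  exact/open_preim/open_dom_chart.
split=> //; first by move=> z [].
  by split; [exact: img_chart | rewrite /= chartK].
apply: (@smooth_on_ext _ _ _ ((f \o ichart x0) \o (fun z => chart x0 (ichart x
  z)))) => //.
  by move=> z [xz [/= x0z O0z]]; rewrite /= chartK.
apply: (smooth_on_chain (O := D0)) => //; first by move=> z [_ []].
move=> j; apply: smooth_on_sub (@smooth_transition x x0 j).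
by move=> z [xz [x0z _]].
Qed.

Lemma smooth_at_local f w : smooth_at f w ->
  exists D : set M, [/\ open D, D w & forall y, D y -> smooth_at f y].
Proof.
move=> hf; have [D [oO Ow Owx sO]] := smooth_atP hf (dom_mem w).
exists (dom w `&` chart w @^-1` D); split; first exact: open_dom_chart.
  by split => //; exact: dom_mem.
by move=> y [wy Oy]; exists w, D.
Qed.

Lemma smooth_at_ext (A : set M) f g w : open A -> A w ->
  (forall y, A y -> f y = g y) -> smooth_at f w -> smooth_at g w.
Proof.
move=> oA Aw fg hf; have [D [oO Ow Owx sO]] := smooth_atP hf (dom_mem w).
exists w, (D `&` preim w A).
have oI : open (D `&` preim w A) by apply: openI => //; exact: open_preim.
split=> //; first by move=> z [/Ow].
- exact: dom_mem.
- by split => //; split; [exact: img_self | rewrite /= ichart_chart_self].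
- apply: (smooth_on_ext (f := f \o ichart w)) => //.
    by move=> z [_ [_ Az]]; exact: fg.
  by apply: smooth_on_sub sO => z [].
Qed.

Lemma smooth_on_img (A : set 'rV[R]_m) f x : A `<=` img x ->
  (forall z, A z -> smooth_at f (ichart x z)) ->
  smooth_on A (f \o ichart x).
Proof.
move=> Ax hf; apply: smooth_on_local => z Az.
have [D [oO Ox Oz sO]] := smooth_atP (hf _ Az) (ichart_dom (Ax _ Az)).
by exists D => //; rewrite ichartK // in Oz; exact: Ax.
Qed.

Lemma smooth_at_img (D : set 'rV[R]_m) f x z : open D -> D `<=` img x -> D z ->
  smooth_on D (f \o ichart x) -> smooth_at f (ichart x z).
Proof.
move=> oO Ox Oz hf; exists x, D; split=> //; first exact: ichart_dom (Ox _ Oz).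
by rewrite ichartK //; exact: Ox.
Qed.

Lemma smooth_at_coord x y j : dom x y -> smooth_at (coord x j) y.
Proof.
move=> xy; exists x, (preim x (dom x)).
split=> //; first exact/open_preim/dom_open.
- by move=> z [].
- by split; [exact: img_chart | rewrite /= chartK].
- exact: smooth_transition.
Qed.

Lemma smooth_at2 f g (h : (M -> R)) w : smooth_at f w -> smooth_at g w ->
  (forall D : set 'rV[R]_m, open D -> smooth_on D (f \o ichart w) ->
     smooth_on D (g \o ichart w) -> smooth_on D (h \o ichart w)) ->
  smooth_at h w.
Proof.
move=> hf hg H; have [D [oO Ow Owx sO]] := smooth_atP hf (dom_mem w).
have [D' [oO' Ow' Owx' sO']] := smooth_atP hg (dom_mem w).
exists w, (D `&` D'); split=> //; first exact: openI.
- by move=> z [/Ow].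
- exact: dom_mem.
- by apply: H; [exact: openI | apply: smooth_on_sub sO => z [] |
    apply: smooth_on_sub sO' => z []].
Qed.

Lemma smooth_atD f g w : smooth_at f w -> smooth_at g w ->
  smooth_at (fun y => f y + g y) w.
Proof.
by move=> hf hg; apply: (smooth_at2 hf hg) => D oO; exact: smooth_onD.
Qed.

Lemma smooth_atM f g w : smooth_at f w -> smooth_at g w ->
  smooth_at (fun y => f y * g y) w.
Proof.
by move=> hf hg; apply: (smooth_at2 hf hg) => D oO; exact: smooth_onM.
Qed.

Lemma smooth_atN f w : smooth_at f w -> smooth_at (fun y => - f y) w.
Proof.
by move=> hf; apply: (smooth_at2 hf hf) => D oO h _; exact: smooth_onN.
Qed.

Lemma smooth_at_cst (c : R) w : smooth_at (fun=> c) w.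
Proof.
exists w, (img w); split=> //; [exact: img_open|exact: dom_mem|exact:
  img_self|].
exact: smooth_on_cst.
Qed.

(** For [y] in [dom x], the inverse of [of_chart x y]: it turns components in the chart at [y] into
    components in [chart x]. *)
Definition tcomp x y v : 'rV[R]_m := \row_j der y v (coord x j).

Lemma der_ext (A : set M) f g y v : open A -> A y ->
  (forall w, A w -> f w = g w) -> der y v f = der y v g.
Proof.
move=> oA Ay fg; apply: near_eq_derive.
have : nbhs (chart y y) (preim y A).
  apply: open_nbhs_nbhs; split; first exact: open_preim.
  by split; [exact: img_self | rewrite /= ichart_chart_self].
by apply: filterS => z [_ Az]; exact: fg.
Qed.

Lemma preim_nbhs x y (A : set M) : dom x y -> open A -> A y ->
  nbhs (chart x y) (preim x A).
Proof.
move=> xy oA Ay; apply: open_nbhs_nbhs; split; first exact: open_preim.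
by split; [exact: img_chart | rewrite /= chartK].
Qed.

Lemma der_chart x y v f : dom x y -> smooth_at f y ->
  der y v f = 'D_(tcomp x y v) (f \o ichart x) (chart x y).
Proof.
move=> xy hf; have [D [oO Ox Oy sO]] := smooth_atP hf xy.
rewrite /der (_ : 'D_v _ _ =
    'D_v ((f \o ichart x) \o (fun z => chart x (ichart y z))) (chart y y)).
  rewrite (derive_chain oO) ?ichart_chart_self //.
  move=> j; apply: (smooth_on_derivable (@smooth_transition y x j)).
  by split; [exact: img_self | rewrite /= ichart_chart_self].
apply: near_eq_derive.
apply: filterS (preim_nbhs (dom_mem y) (dom_open x) xy) => z [_ xz].
by rewrite /= chartK.
Qed.

Lemma der_of_chart x y u f : dom x y -> smooth_at f y ->
  der y (of_chart x y u) f = 'D_u (f \o ichart x) (chart x y).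
Proof.
move=> xy hf; have [D [oO Oy Oyy sO]] := smooth_atP hf (dom_mem y).
rewrite [RHS](_ : _ =
    'D_u ((f \o ichart y) \o (fun z => chart y (ichart x z))) (chart x y)).
  rewrite (derive_chain oO) ?chartK //.
  move=> j; apply: (smooth_on_derivable (@smooth_transition x y j)).
  by split; [exact: img_chart | rewrite /= chartK //; exact: dom_mem].
apply: near_eq_derive.
apply: filterS (preim_nbhs xy (dom_open y) (dom_mem y)) => z [_ yz].
by rewrite /= chartK.
Qed.

Lemma derive_coord u (z : 'rV[R]_m) (j : 'I_m) :
  'D_u (fun z : 'rV[R]_m => z ord0 j) z = u ord0 j.
Proof.
have d : derivable (fun z : 'rV[R]_m => z) z u by exact: derivable_id.
have := derive_row d; rewrite derive_id => /rowP/(_ j); rewrite mxE => <-.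
by [].
Qed.

Lemma derive_coord_ichart x y u j : dom x y ->
  'D_u (coord x j \o ichart x) (chart x y) = u ord0 j.
Proof.
move=> xy; rewrite -(derive_coord u (chart x y) j); apply: near_eq_derive.
apply: filterS (preim_nbhs xy openT I) => z [xz _].
by rewrite /= /coord ichartK.
Qed.

Lemma tcomp_of_chart x y u : dom x y -> tcomp x y (of_chart x y u) = u.
Proof.
move=> xy; apply/rowP => j; rewrite mxE der_of_chart //.
  exact: derive_coord_ichart.
exact: smooth_at_coord.
Qed.

Lemma tcomp_self x v : tcomp x x v = v.
Proof.
apply/rowP => j; rewrite mxE; apply: derive_coord_ichart; exact: dom_mem.
Qed.

Lemma of_chart_tcomp x y v : dom x y -> of_chart x y (tcomp x y v) = v.
Proof.
move=> xy; rewrite -[RHS](tcomp_self y); apply/rowP => j; rewrite !mxE.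
by rewrite -der_chart //; exact/smooth_at_coord/dom_mem.
Qed.

Lemma of_chart_self x u : of_chart x x u = u.
Proof.
by rewrite -{2}(@tcomp_of_chart x x u) ?tcomp_self //; exact: dom_mem.
Qed.

Lemma derDv y u v f : smooth_at f y -> der y (u + v) f = der y u f + der y v f.
Proof.
move=> hf; have [D [oO Oy Oyy sO]] := smooth_atP hf (dom_mem y).
exact: smooth_on_deriveDv Oyy sO.
Qed.

Lemma derZv y v (k : R) f : smooth_at f y -> der y (k *: v) f = k * der y v f.
Proof.
move=> hf; have [D [oO Oy Oyy sO]] := smooth_atP hf (dom_mem y).
exact: smooth_on_deriveZv Oyy sO.
Qed.

Lemma derNv y v f : smooth_at f y -> der y (- v) f = - der y v f.
Proof. by move=> hf; rewrite -scaleN1r derZv // mulN1r. Qed.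

Lemma der0v y f : der y 0 f = 0.
Proof. exact: derive0. Qed.

Lemma der_rowE y v f : smooth_at f y ->
  der y v f = \sum_k v ord0 k * der y (delta_mx 0 k) f.
Proof.
move=> hf; have [D [oO Oy Oyy sO]] := smooth_atP hf (dom_mem y).
exact: derive_rowE Oyy sO.
Qed.

Lemma tcompD x y u v : dom x y -> tcomp x y (u + v) = tcomp x y u + tcomp x y v.
Proof.
by move=> xy; apply/rowP => j; rewrite !mxE derDv //; exact: smooth_at_coord.
Qed.

Lemma tcompZ x y (k : R) v : dom x y -> tcomp x y (k *: v) = k *: tcomp x y v.
Proof.
by move=> xy; apply/rowP => j; rewrite !mxE derZv //; exact: smooth_at_coord.
Qed.

Lemma of_chartD x y u v : dom x y ->
  of_chart x y (u + v) = of_chart x y u + of_chart x y v.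
Proof.
move=> xy; rewrite -{1}(tcomp_of_chart u xy) -{1}(tcomp_of_chart v xy) -tcompD
  //.
exact: of_chart_tcomp.
Qed.

Lemma of_chartZ x y (k : R) u : dom x y ->
  of_chart x y (k *: u) = k *: of_chart x y u.
Proof.
move=> xy; rewrite -{1}(tcomp_of_chart u xy) -tcompZ //; exact: of_chart_tcomp.
Qed.

Lemma of_chart0 x y : of_chart x y 0 = 0.
Proof. by apply/rowP => j; rewrite !mxE derive0. Qed.

Lemma of_chart_rowE x y u : dom x y ->
  of_chart x y u = \sum_a u ord0 a *: of_chart x y (delta_mx 0 a).
Proof.
move=> xy; rewrite {1}[u]row_sum_delta.
elim: (index_enum _) => [|a r IH]; first by rewrite !big_nil of_chart0.
by rewrite !big_cons of_chartD // of_chartZ // IH.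
Qed.

End Charts.

(** * Vector fields and brackets *)

Section Fields.
Context {R : realType} {m : nat} {M : manifold R m}.
Implicit Types (x y w : M) (f g : M -> R) (X Y Z : field M).

Lemma smooth_fieldP X : smooth_field X <->
  forall x y j, dom x y -> smooth_at (act X (coord x j)) y.
Proof.
split=> [hX x y j xy|hX x j].
  by exists x, (img x); split=> //; [exact: img_open | exact: img_chart].
by apply: smooth_on_img => // z xz; apply: hX; exact: ichart_dom.
Qed.

Lemma act_chart X f x z : img x z -> smooth_at f (ichart x z) ->
  act X f (ichart x z) = \sum_k act X (coord x k) (ichart x z) *
    'D_(delta_mx 0 k) (f \o ichart x) z.
Proof.
move=> xz hf; have [D [oO Ox Oz sO]] := smooth_atP hf (ichart_dom xz).
rewrite /act (der_chart _ (ichart_dom xz)) // (derive_rowE _ oO Oz sO).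
by rewrite ichartK //; apply: eq_bigr => k _; rewrite mxE.
Qed.

Lemma smooth_act X f y : smooth_field X -> smooth_at f y ->
  smooth_at (act X f) y.
Proof.
move=> hX hf; have [D [oO Oy Oyy sO]] := smooth_atP hf (dom_mem y).
exists y, D; split; [exact: oO|exact: Oy|exact: dom_mem|exact: Oyy|].
apply: (smooth_on_ext (f := fun z => \sum_k act X (coord y k) (ichart y z) *
    'D_(delta_mx 0 k) (f \o ichart y) z)); first exact: oO.
  move=> z Oz; rewrite /= act_chart //; first exact: Oy.
  exact: smooth_at_img oO Oy Oz sO.
apply: smooth_on_sum => [|k]; first exact: oO.
apply: smooth_onM; [exact: oO| |exact: smooth_onS sO].
exact: smooth_on_sub (hX y k).
Qed.

Lemma smooth_fieldD X Y : smooth_field X -> smooth_field Y ->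
  smooth_field (fun y => X y + Y y).
Proof.
move=> /smooth_fieldP hX /smooth_fieldP hY; apply/smooth_fieldP => x y j xy.
apply: (smooth_at_ext (A := dom x) (f :=
  fun y => act X (coord x j) y + act Y (coord x j) y)) => //.
- exact: dom_open.
- by move=> w xw; rewrite /act derDv //; exact: smooth_at_coord.
- by apply: smooth_atD; [exact: hX | exact: hY].
Qed.

Lemma smooth_fieldZ f X : (forall y, smooth_at f y) -> smooth_field X ->
  smooth_field (fun y => f y *: X y).
Proof.
move=> hf /smooth_fieldP hX; apply/smooth_fieldP => x y j xy.
apply: (smooth_at_ext (A := dom x) (f :=
  fun y => f y * act X (coord x j) y)) => //.
- exact: dom_open.
- by move=> w xw; rewrite /act derZv //; exact: smooth_at_coord.
- by apply: smooth_atM; [exact: hf | exact: hX].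
Qed.

Lemma smooth_field0 : smooth_field ((fun=> 0) : field M).
Proof.
apply/smooth_fieldP => x y j xy.
have -> : act ((fun=> 0) : field M) (coord x j) = fun=> 0.
  by apply/funext => w; exact: der0v.
exact: smooth_at_cst.
Qed.

Lemma smooth_fieldB X Y : smooth_field X -> smooth_field Y ->
  smooth_field (fun y => X y - Y y).
Proof.
move=> hX hY.
have -> : (fun y => X y - Y y) = (fun y => X y + (fun=> -1) y *: Y y).
  by apply/funext => y; rewrite scaleN1r.
by apply: (smooth_fieldD hX); apply: smooth_fieldZ hY => y;
  exact: smooth_at_cst.
Qed.

Lemma smooth_field_sum (I : Type) (r : seq I) (F : I -> field M) :
  (forall i, smooth_field (F i)) ->
  smooth_field (fun y => \sum_(i <- r) F i y).
Proof.
move=> hF; elim: r => [|i r IH].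
  under eq_fun do rewrite big_nil; exact: smooth_field0.
under eq_fun do rewrite big_cons; exact: (smooth_fieldD (hF i) IH).
Qed.

Lemma bracketE X Y x : bracket X Y x =
  \row_j (der x (X x) (act Y (coord x j)) - der x (Y x) (act X (coord x j))).
Proof. by []. Qed.

(** The definition of [bracket] tests only the coordinates selected at [x]. For general [f], the
    product rule applied to [Y f = \sum_k Y^k * d_k f] leaves that first-order part plus
    second-order terms, which cancel by symmetry of second derivatives. *)
Lemma act_bracket X Y f x : smooth_field X -> smooth_field Y -> smooth_at f x ->
  act (bracket X Y) f x = act X (act Y f) x - act Y (act X f) x.
Proof.
move=> hX hY hf; have [D [oO Ox Oxx sO]] := smooth_atP hf (dom_mem x).
set F := f \o ichart x in sO; set z0 := chart x x in Oxx.
pose d k := delta_mx 0 k : 'rV[R]_m.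
have actE Z z : D z -> act Z f (ichart x z) =
    \sum_k act Z (coord x k) (ichart x z) * 'D_(d k) F z.
  by move=> Oz; rewrite act_chart //; [exact: Ox | exact: smooth_at_img sO].
have second Z Z' : smooth_field Z -> act Z' (act Z f) x =
    \sum_k (act Z' (act Z (coord x k)) x * 'D_(d k) F z0
            + Z x ord0 k * 'D_(Z' x) ('D_(d k) F) z0).
  move=> hZ; rewrite [LHS](_ : _ = 'D_(Z' x) (act Z f \o ichart x) z0) //.
  rewrite (near_eq_derive (g := fun z => \sum_k act Z (coord x k) (ichart x z) *
     'D_(d k) F z)); last first.
    have : nbhs z0 D by exact: open_nbhs_nbhs.
    by apply: filterS => z Oz; rewrite /= actE.
  have hD : is_derive z0 (Z' x) (fun z => \sum_k act Z (coord x k) (ichart x z)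
    *
     'D_(d k) F z) (\sum_k (act Z' (act Z (coord x k)) x * 'D_(d k) F z0
            + act Z (coord x k) (ichart x z0) * 'D_(Z' x) ('D_(d k) F) z0)).
    apply: is_derive_sumf => k; apply: is_deriveMf; apply: derivableP.
      exact: (smooth_on_derivable (hZ x k)) (img_self x).
    exact: (smooth_on_derivable (smooth_onS _ sO)) Oxx.
  case: hD => _ ->; apply: eq_bigr => k _; congr (_ + _ * _).
  rewrite ichart_chart_self -[in RHS](tcomp_self x (Z x)) mxE; by [].
rewrite !second // -sumrB /act /der (derive_rowE _ oO Oxx sO).
under [in RHS]eq_bigr do rewrite opprD addrACA -mulrBl.
rewrite [in RHS]big_split /= [X in _ + X](_ : _ = 0) ?addr0.
  by apply: eq_bigr => k _; rewrite bracketE mxE.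
rewrite sumrB; apply/eqP; rewrite subr_eq0; apply/eqP.
have dd u v : 'D_u ('D_v F) z0 = 'D_v ('D_u F) z0.
  exact: smooth_on_derive_swap Oxx sO.
have E Z Z' : \sum_k Z x ord0 k * 'D_(Z' x) ('D_(d k) F) z0 = 'D_(Z x) ('D_(Z'
  x) F) z0.
  rewrite (derive_rowE (Z x) oO Oxx (smooth_onS _ sO)).
  by apply: eq_bigr => k _; rewrite dd.
apply: (etrans (E Y X)); apply: (etrans _ (esym (E X Y))); exact: dd.
Qed.

(** [bracket] is defined with a chart that changes from point to point; [act_bracket] gives its
    components in one fixed chart, where smoothness is tested. *)
Lemma smooth_bracket X Y : smooth_field X -> smooth_field Y ->
  smooth_field (bracket X Y).
Proof.
move=> hX hY; apply/smooth_fieldP => x y j xy.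
apply: (smooth_at_ext (A := dom x) (f := fun y => act X (act Y (coord x j)) y +
   - act Y (act X (coord x j)) y)) => //.
- exact: dom_open.
- by move=> w xw; rewrite act_bracket //; exact: smooth_at_coord.
- have hc := smooth_at_coord j xy.
  exact: (smooth_atD (smooth_act hX (smooth_act hY hc))
    (smooth_atN (smooth_act hY (smooth_act hX hc)))).
Qed.

Lemma bracketC X Y x : bracket X Y x = - bracket Y X x.
Proof. by apply/rowP => j; rewrite !mxE opprB. Qed.

End Fields.

(** * Derivatives of matrix curves *)

Section MatrixCurves.
Context {R : realType}.

Lemma is_derive_mxP m n (A : R -> 'M[R]_(m, n)) (t : R) dA :
  is_derive t 1 A dA <->
  forall i j, is_derive t 1 (fun s => A s i j) (dA i j).
Proof.
split=> [[hA <-] i j|H].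
  by split; [exact: (derivable_mxP _ _ _).1 | rewrite derive_mx // mxE].
have hA : derivable A t 1.
  by apply/derivable_mxP => i j; case: (H i j).
by split=> //; rewrite derive_mx //; apply/matrixP => i j; rewrite mxE;
  case: (H i j).
Qed.

Lemma is_derive_mulmx m n p (A : R -> 'M[R]_(m, n)) (B : R -> 'M[R]_(n, p))
    (t : R) dA dB :
  is_derive t 1 A dA -> is_derive t 1 B dB ->
  is_derive t 1 (fun s => A s *m B s) (dA *m B t + A t *m dB).
Proof.
move=> /is_derive_mxP hA /is_derive_mxP hB; apply/is_derive_mxP => i j.
rewrite !mxE -big_split /=.
under eq_fun do rewrite mxE.
by apply: is_derive_sumf => k; exact: is_deriveMf.
Qed.

Lemma is_derive_trmx m n (A : R -> 'M[R]_(m, n)) (t : R) dA :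
  is_derive t 1 A dA -> is_derive t 1 (fun s => (A s)^T) dA^T.
Proof.
move=> /is_derive_mxP hA; apply/is_derive_mxP => i j; rewrite mxE.
by under eq_fun do rewrite mxE.
Qed.

Lemma is_derive_quad m (G : R -> 'M[R]_m) (A B : R ->
  'rV[R]_m) (t : R) dG dA dB :
  is_derive t 1 G dG -> is_derive t 1 A dA -> is_derive t 1 B dB ->
  is_derive t 1 (fun s => (A s *m G s *m (B s)^T) ord0 ord0)
    ((A t *m dG *m (B t)^T) ord0 ord0 + (dA *m G t *m (B t)^T) ord0 ord0
     + (A t *m G t *m dB^T) ord0 ord0).
Proof.
move=> hG hA hB.
have /is_derive_mxP/(_ ord0 ord0) :=
  is_derive_mulmx (is_derive_mulmx hA hG) (is_derive_trmx hB).
move=> H; apply: (is_derive_eq H).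
by rewrite mulmxDl mxE [X in X + _]mxE [X in X + _ = _]addrC.
Qed.

End MatrixCurves.

(** * Metrics and families depending on time *)

Section InnerProduct.
Context {R : realType} {m : nat} {M : manifold R m}.
Implicit Types (g : form M) (x : M) (u v w : 'rV[R]_m).

Lemma ipDl g x u v w : ip g x (u + v) w = ip g x u w + ip g x v w.
Proof. by rewrite /ip !mulmxDl mxE. Qed.

Lemma ipDr g x u v w : ip g x w (u + v) = ip g x w u + ip g x w v.
Proof. by rewrite /ip linearD mulmxDr mxE. Qed.

Lemma ipZl g x (k : R) v w : ip g x (k *: v) w = k * ip g x v w.
Proof. by rewrite /ip -!scalemxAl mxE. Qed.

Lemma ipZr g x (k : R) v w : ip g x v (k *: w) = k * ip g x v w.
Proof. by rewrite /ip linearZ -scalemxAr mxE. Qed.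

Lemma ipNl g x v w : ip g x (- v) w = - ip g x v w.
Proof. by rewrite -scaleN1r ipZl mulN1r. Qed.

Lemma ipNr g x v w : ip g x v (- w) = - ip g x v w.
Proof. by rewrite -scaleN1r ipZr mulN1r. Qed.

Lemma ipBl g x u v w : ip g x (u - v) w = ip g x u w - ip g x v w.
Proof. by rewrite ipDl ipNl. Qed.

Lemma ip0l g x w : ip g x 0 w = 0.
Proof. by rewrite /ip !mul0mx mxE. Qed.

Lemma ip0r g x w : ip g x w 0 = 0.
Proof. by rewrite /ip trmx0 mulmx0 mxE. Qed.

Lemma ip_suml g x (I : Type) (r : seq I) (F : I -> 'rV[R]_m) w :
  ip g x (\sum_(i <- r) F i) w = \sum_(i <- r) ip g x (F i) w.
Proof.
by elim: r => [|i r IH]; rewrite ?big_nil ?ip0l // !big_cons ipDl IH.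
Qed.

Lemma ip_sumr g x (I : Type) (r : seq I) (F : I -> 'rV[R]_m) w :
  ip g x w (\sum_(i <- r) F i) = \sum_(i <- r) ip g x w (F i).
Proof.
by elim: r => [|i r IH]; rewrite ?big_nil ?ip0r // !big_cons ipDr IH.
Qed.

Lemma ip_eq0 g x v : riemannian_metric g -> ip g x v v = 0 -> v = 0.
Proof.
move=> hg v0; apply/eqP; apply/contraT => /(metric_pos hg x).
by rewrite v0 ltxx.
Qed.

Lemma gram_unit g x : riemannian_metric g -> g x \in unitmx.
Proof.
move=> hg; rewrite -row_free_unit -kermx_eq0; apply/eqP/row_matrixP => i.
rewrite row0; apply: (ip_eq0 hg (x := x)); rewrite /ip.
by rewrite -row_mul mulmx_ker row0 mul0mx mxE.
Qed.

(** The [xget] in [sharp] never returns its default, since [v *m b x *m invmx (g x)] is a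
    solution. *)
Lemma sharpP g b x v w : riemannian_metric g ->
  ip g x (sharp g b x v) w = ip b x v w.
Proof.
move=> hg; rewrite /sharp; case: xgetP => [u _ /= -> //|].
move=> /(_ (v *m b x *m invmx (g x))) /= []; move=> u.
by rewrite /ip mulmxKV //; exact: gram_unit.
Qed.

Lemma ip_chart g x y u v : dom x y ->
  ip g y (of_chart x y u) (of_chart x y v) =
  \sum_a \sum_b u ord0 a * (v ord0 b *
    ip g y (of_chart x y (delta_mx 0 a)) (of_chart x y (delta_mx 0 b))).
Proof.
move=> xy; rewrite (of_chart_rowE u xy) (of_chart_rowE v xy) ip_suml.
apply: eq_bigr => a _; rewrite ip_sumr; apply: eq_bigr => b _.
by rewrite ipZl ipZr.
Qed.

Lemma smooth_ipf g (X Y : field M) y : smooth_form g ->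
  smooth_field X -> smooth_field Y -> smooth_at (ipf g X Y) y.
Proof.
move=> hg hX hY; exists y, (img y); split=> //.
- exact: img_open.
- exact: dom_mem.
- exact: img_self.
apply: (smooth_on_ext (f := fun z => \sum_a \sum_b act X (coord y a) (ichart y
  z) *
    (act Y (coord y b) (ichart y z) *
    ip g (ichart y z) (of_chart y (ichart y z) (delta_mx 0 a))
       (of_chart y (ichart y z) (delta_mx 0 b))))); first exact: img_open.
  move=> z yz; have yd := ichart_dom yz.
  rewrite /= /ipf -[X _](of_chart_tcomp _ yd) -[Y _](of_chart_tcomp _ yd)
    ip_chart //.
  by apply: eq_bigr => a _; apply: eq_bigr => b _; rewrite !mxE.
apply: smooth_on_sum => [|a]; first exact: img_open.
apply: smooth_on_sum => [|b]; first exact: img_open.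
apply: smooth_onM; [exact: img_open|exact: hX|].
by apply: smooth_onM; [exact: img_open|exact: hY|exact: hg].
Qed.

End InnerProduct.

(** * Time-dependent fields and forms *)

Section Families.
Context {R : realType} {m : nat} {M : manifold R m}.
Variables (I : set R) (oI : open I).
Implicit Types (X Y : R -> field M) (x y : M) (t s : R).

Definition comp_fam X x (j : 'I_m) : R * 'rV[R]_m -> R :=
  fun s : R * 'rV[R]_m => act (X s.1) (coord x j) (ichart x s.2).

Lemma family_field X t : smooth_field_family I X -> I t -> smooth_field (X t).
Proof. by move=> hX It x j; exact: (smooth_on_slice It (hX x j)). Qed.

Lemma comp_fam_self X x j s :
  comp_fam X x j (s, chart x x) = X s x ord0 j.
Proof.
by rewrite /comp_fam /= ichart_chart_self -[in RHS](tcomp_self x (X s x)) mxE.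
Qed.

Lemma is_derive_family X t x : smooth_field_family I X -> I t ->
  is_derive t 1 (fun s => X s x) (dt_field X t x).
Proof.
move=> hX It.
have H : is_derive t 1 (fun s => X s x)
    (\row_j 'D_((1 : R), (0 : 'rV[R]_m)) (comp_fam X x j) (t, chart x x)).
  apply/is_derive_mxP => i j; rewrite (ord1 i) mxE.
  under eq_fun do rewrite -comp_fam_self.
  apply: is_derive_time; apply: (smooth_on_derivable (hX x j)).
  by split; [exact: It | exact: img_self].
by move: (H) => [_ E]; rewrite /dt_field derive1E E.
Qed.

Lemma is_derive_der (A : R -> 'rV[R]_m) dA t x f : smooth_at f x ->
  is_derive t 1 A dA -> is_derive t 1 (fun s => der x (A s) f) (der x dA f).
Proof.
move=> hf /is_derive_mxP hA; rewrite (der_rowE _ hf).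
under eq_fun do rewrite (der_rowE _ hf).
apply: is_derive_sumf => k.
apply: (is_derive_eq (is_deriveMf (hA ord0 k) (is_derive_cst _ _ _))).
by rewrite mulr0 addr0.
Qed.

Lemma is_derive_act X t x f : smooth_field_family I X -> I t -> smooth_at f x ->
  is_derive t 1 (fun s => act (X s) f x) (act (dt_field X t) f x).
Proof.
by move=> hX It hf; exact: (is_derive_der hf (is_derive_family x hX It)).
Qed.

(** [dt_field] differentiates in the chart selected at each point, the left side in one fixed chart.
    They agree because the change of chart is linear on tangent vectors and independent of time. *)
Lemma dt_comp_fam X t x j z : smooth_field_family I X -> I t -> img x z ->
  'D_((1 : R), (0 : 'rV[R]_m)) (comp_fam X x j) (t, z) =
  act (dt_field X t) (coord x j) (ichart x z).
Proof.
move=> hX It xz.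
have [_ <-] := is_derive_act hX It (smooth_at_coord j (ichart_dom xz)).
have [|_ <- //] := @is_derive_time _ _ (comp_fam X x j) t z.
by apply: (smooth_on_derivable (hX x j)); split.
Qed.

Lemma smooth_dt_field X t : smooth_field_family I X -> I t ->
  smooth_field (dt_field X t).
Proof.
move=> hX It x j.
apply: (smooth_on_ext (f := fun z => 'D_((1 : R),
  (0 : 'rV[R]_m)) (comp_fam X x j) (t, z))).
- exact: img_open.
- by move=> z xz; rewrite dt_comp_fam.
- apply: (smooth_on_slice It (F :=
  'D_((1 : R), (0 : 'rV[R]_m)) (comp_fam X x j))).
  exact: smooth_onS (hX x j).
Qed.

(** In the chart at [x] the function is [\sum_k X^k * d_k Y^j]. The product rule gives the two
    terms, once [d/dt] and [d_k] are exchanged by symmetry of second derivatives on the product of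
    time and chart. *)
Lemma is_derive_act_coord X Y t x j :
  smooth_field_family I X -> smooth_field_family I Y -> I t ->
  is_derive t 1 (fun s => act (X s) (act (Y s) (coord x j)) x)
    (act (dt_field X t) (act (Y t) (coord x j)) x
     + act (X t) (act (dt_field Y t) (coord x j)) x).
Proof.
move=> hX hY It.
pose G := comp_fam Y x j; pose z0 := chart x x.
pose d k := delta_mx 0 k : 'rV[R]_m.
have oix : open (img x) := @img_open _ _ M x.
have iz0 : img x z0 := img_self x.
have hG : smooth_on (box I (img x)) G := hY x j.
have E s v : I s -> der x v (act (Y s) (coord x j)) =
    \sum_k v ord0 k * 'D_((0 : R), d k) G (s, z0).
  move=> Is; rewrite /der -/z0.
  rewrite (derive_rowE v oix iz0 (F := fun z => G (s, z))); last first.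
    exact: (smooth_on_slice Is hG).
  by apply: eq_bigr => k _; rewrite -derive_slice.
have H : is_derive t 1 (fun s => \sum_k X s x ord0 k * 'D_((0 : R), d k) G (s,
  z0))
    (\sum_k (dt_field X t x ord0 k * 'D_((0 : R), d k) G (t, z0) +
      X t x ord0 k * 'D_((1 : R), (0 : 'rV[R]_m)) ('D_((0 : R), d k) G) (t,
        z0))).
  apply: is_derive_sumf => k; apply: is_deriveMf.
    by have /is_derive_mxP := is_derive_family x hX It.
  apply: is_derive_time; apply: (smooth_on_derivable (smooth_onS _ hG)).
  by split.
have nI : \forall s \near t, I s by apply: open_nbhs_nbhs.
have H2 : is_derive t 1 (fun s => act (X s) (act (Y s) (coord x j)) x)
  (\sum_k (dt_field X t x ord0 k * 'D_((0 : R), d k) G (t, z0) +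
      X t x ord0 k * 'D_((1 : R), (0 : 'rV[R]_m)) ('D_((0 : R), d k) G) (t,
        z0))).
  by apply: near_eq_is_derive H; apply: filterS nI => s Is; rewrite -E.
apply: (is_derive_eq H2); rewrite big_split; apply: (congr2 +%R).
  exact: esym (E t _ It).
rewrite [RHS](_ : _ = 'D_(X t x) (act (dt_field Y t) (coord x j) \o ichart x)
  z0) //.
have sdt : smooth_on (img x) (act (dt_field Y t) (coord x j) \o ichart x).
  exact: smooth_dt_field.
rewrite [RHS](derive_rowE _ oix iz0 sdt); apply: eq_bigr => k _.
apply: (congr2 *%R (erefl _)).
rewrite (smooth_on_derive_swap _ _ (open_box oI oix) _ hG); last by split.
rewrite -derive_slice; apply: near_eq_derive.
have : nbhs z0 (img x) by exact: open_nbhs_nbhs.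
by apply: filterS => z xz; rewrite dt_comp_fam.
Qed.

Lemma bracketEx (Z Z' : field M) x (i : 'I_1) j : bracket Z Z' x i j =
  act Z (act Z' (coord x j)) x - act Z' (act Z (coord x j)) x.
Proof. by rewrite mxE. Qed.

Lemma is_derive_bracket X Y t x :
  smooth_field_family I X -> smooth_field_family I Y -> I t ->
  is_derive t 1 (fun s => bracket (X s) (Y s) x)
    (bracket (dt_field X t) (Y t) x + bracket (X t) (dt_field Y t) x).
Proof.
move=> hX hY It; apply/is_derive_mxP => i j.
under eq_fun do rewrite mxE.
apply: (is_derive_eq (is_deriveBf (is_derive_act_coord x j hX hY It)
  (is_derive_act_coord x j hY hX It))).
rewrite [RHS]mxE; apply: (etrans _ (esym (congr2 +%R (bracketEx _ _ _ _ _)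
  (bracketEx _ _ _ _ _)))).
have alg (a b c d : R) : a + b - (c + d) = a - d + (b - c) by ring.
exact: alg.
Qed.

Lemma family_cst (X : field M) : smooth_field X ->
  smooth_field_family I (fun=> X).
Proof. by move=> hX x j; exact: (smooth_on_snd (I := I) (hX x j)). Qed.

Lemma is_derive_form (g : R -> form M) t x : smooth_form_family I g -> I t ->
  is_derive t 1 (fun s => g s x) (dt_form g t x).
Proof.
move=> hg It.
pose F a b (s : R * 'rV[R]_m) := ip (g s.1) (ichart x s.2)
  (of_chart x (ichart x s.2) (delta_mx 0 a)) (of_chart x (ichart x s.2)
    (delta_mx 0 b)).
have H : is_derive t 1 (fun s => g s x)
    (\matrix_(a, b) 'D_((1 : R), (0 : 'rV[R]_m)) (F a b) (t, chart x x)).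
  apply/is_derive_mxP => a b; rewrite mxE.
  have -> : (fun s => g s x a b) = (fun s => F a b (s, chart x x)).
    apply/funext => s; rewrite /F /= ichart_chart_self !of_chart_self.
    by rewrite /ip -rowE trmx_delta -colE !mxE.
  apply: is_derive_time; apply: (smooth_on_derivable (hg x _ _)).
  by split; [exact: It | exact: img_self].
by move: (H) => [_ E]; rewrite /dt_form derive1E E.
Qed.

Lemma is_derive_ip (g : R -> form M) (A B : R -> 'rV[R]_m) dA dB t x :
  smooth_form_family I g -> I t ->
  is_derive t 1 A dA -> is_derive t 1 B dB ->
  is_derive t 1 (fun s => ip (g s) x (A s) (B s))
    (ip (dt_form g t) x (A t) (B t) + ip (g t) x dA (B t) + ip (g t) x (A t)
      dB).
Proof.
move=> hg It hA hB.
exact: (is_derive_quad (is_derive_form x hg It) hA hB).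
Qed.

End Families.

(** * Linear algebra of the horizontal lift *)

Section HorizontalMatrix.
Context {R : realType} {m p : nat}.
Implicit Types (G : 'M[R]_m) (P : 'M[R]_(m, p)) (w : 'rV[R]_p).

(* The [u] with [u *m P = w] that is [G]-orthogonal to the kernel of [P]: in a
   chart it is the horizontal lift, and depends smoothly on [G] and [P]. *)
Definition hlift_mx G P w : 'rV[R]_m :=
  w *m invmx (P^T *m invmx G *m P) *m (P^T *m invmx G).

Lemma sqr_rV_eq0 k (c : 'rV[R]_k) : (c *m c^T) ord0 ord0 = 0 -> c = 0.
Proof.
rewrite mxE => c0.
have H i : true -> 0 <= c ord0 i * c^T i ord0 by rewrite mxE -expr2 sqr_ge0.
apply/rowP => j; apply/eqP; rewrite !mxE -sqrf_eq0 expr2.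
by have /eqP := psumr_eq0P H c0 (i := j) isT; rewrite mxE.
Qed.

(** [P^T *m invmx G *m P] is the dual form of [G] on covectors pulled back by [P]. A kernel vector
    [c] yields [a = c *m P^T *m invmx G] with [a *m G *m a^T = 0], so [c *m P^T = 0]; writing
    [c = u *m P] then gives [c *m c^T = 0]. *)
Lemma schur_unit G P : G \in unitmx -> G^T = G ->
  (forall v : 'rV[R]_m, v != 0 -> 0 < (v *m G *m v^T) ord0 ord0) ->
  (forall w, exists u, u *m P = w) -> P^T *m invmx G *m P \in unitmx.
Proof.
move=> uG sG posG surjP; rewrite -row_free_unit -kermx_eq0.
apply/eqP/row_matrixP => i; rewrite row0.
set c := row i _.
have cS : c *m (P^T *m invmx G *m P) = 0 by rewrite /c -row_mul mulmx_ker row0.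
pose a := c *m P^T *m invmx G.
have aG : a *m G = c *m P^T by rewrite /a mulmxKV.
have a0 : a = 0.
  apply/eqP; apply/contraT => /posG.
  have -> : a *m G *m a^T = 0.
    rewrite /a mulmxKV // !trmx_mul trmx_inv sG trmxK.
    by rewrite !mulmxA -[RHS](mul0mx _ c^T) -cS !mulmxA.
  by rewrite mxE ltxx.
have cP : c *m P^T = 0 by rewrite -aG a0 mul0mx.
have [u uP] := surjP c; apply: sqr_rV_eq0.
by rewrite -{2}uP trmx_mul mulmxA cP mul0mx mxE.
Qed.

Lemma hlift_mxP G P w : P^T *m invmx G *m P \in unitmx ->
  hlift_mx G P w *m P = w.
Proof.
by move=> uS; rewrite /hlift_mx -!mulmxA [P^T *m _]mulmxA mulVmx // mulmx1.
Qed.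

Lemma hlift_mx_orth G P w (u : 'rV[R]_m) : G \in unitmx -> u *m P = 0 ->
  (hlift_mx G P w *m G *m u^T) ord0 ord0 = 0.
Proof.
move=> uG uP; rewrite /hlift_mx !mulmxA mulmxKV // -[_ *m P^T *m u^T]mulmxA.
by rewrite -trmx_mul uP trmx0 mulmx0 mxE.
Qed.

End HorizontalMatrix.

(** * Submersions and horizontal lifts *)

Section SmoothMaps.
Context {R : realType} {m p : nat} {M : manifold R m} {N : manifold R p}.
Variables (pi : M -> N) (hpi : smooth_map pi).
Implicit Types (x y : M) (q : N) (v : 'rV[R]_m) (h : N -> R).

Lemma open_preimage (A : set N) : open A -> open (pi @^-1` A).
Proof. by move=> oA; apply: open_comp => // y _; exact: hpi.1. Qed.

Lemma smooth_pi x q (j : 'I_p) :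
  smooth_on (preim x (pi @^-1` dom q)) (coord q j \o pi \o ichart x).
Proof. by rewrite -image_dom_preim; exact: hpi.2. Qed.

Lemma open_pi x q : open (preim x (pi @^-1` dom q)).
Proof. exact/open_preim/open_preimage/dom_open. Qed.

Lemma smooth_at_comp h y : smooth_at h (pi y) -> smooth_at (h \o pi) y.
Proof.
move=> hh; have [D [oD Dq Dqq sD]] := smooth_atP hh (dom_mem (pi y)).
set q := pi y in D oD Dq Dqq sD.
pose A := pi @^-1` (dom q `&` chart q @^-1` D).
have oA : open A by exact/open_preimage/open_dom_chart.
exists y, (preim y A); split=> //.
- exact: open_preim.
- by move=> z [].
- exact: dom_mem.
- split; first exact: img_self.
  by rewrite /= ichart_chart_self; split => //; exact: dom_mem.
apply: (smooth_on_ext (f := (h \o ichart q) \o (fun z => chart q (pi (ichart y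
  z))))).
- exact: open_preim.
- by move=> z [_ [/= qz _]]; rewrite chartK.
apply: (smooth_on_chain (O := D)) => //.
- exact: open_preim.
- by move=> z [_ []].
- move=> j; apply: smooth_on_sub (@smooth_pi y q j).
  by move=> z [yz [qz _]].
Qed.

Lemma smooth_at_coord_pi q y j : dom q (pi y) -> smooth_at (coord q j \o pi) y.
Proof. by move=> qy; exact/smooth_at_comp/smooth_at_coord. Qed.

Lemma der_dmap h y v : smooth_at h (pi y) ->
  der y v (h \o pi) = der (pi y) (dmap pi y v) h.
Proof.
move=> hh; have [D [oD Dq Dqq sD]] := smooth_atP hh (dom_mem (pi y)).
rewrite [LHS](_ : _ = 'D_v ((h \o ichart (pi y)) \o
   (fun z => chart (pi y) (pi (ichart y z)))) (chart y y)).
  rewrite (derive_chain oD) ?ichart_chart_self //.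
  move=> j; apply: (smooth_on_derivable (@smooth_pi y (pi y) j)).
  by split; [exact: img_self | rewrite /= ichart_chart_self; exact: dom_mem].
apply: near_eq_derive.
have : nbhs (chart y y) (preim y (pi @^-1` dom (pi y))).
  by apply: preim_nbhs; [exact: dom_mem | exact/open_preimage/dom_open | exact:
    dom_mem].
by apply: filterS => z [_ qz]; rewrite /= chartK.
Qed.

Lemma dmapE y v j : dmap pi y v ord0 j = der y v (coord (pi y) j \o pi).
Proof. by rewrite mxE. Qed.

Lemma dmapD y u v : dmap pi y (u + v) = dmap pi y u + dmap pi y v.
Proof.
apply/rowP => j; rewrite !mxE derDv //; exact/smooth_at_coord_pi/dom_mem.
Qed.

Lemma dmapZ y (k : R) v : dmap pi y (k *: v) = k *: dmap pi y v.
Proof.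
apply/rowP => j; rewrite !mxE derZv //; exact/smooth_at_coord_pi/dom_mem.
Qed.

Lemma dmapN y v : dmap pi y (- v) = - dmap pi y v.
Proof. by rewrite -scaleN1r dmapZ scaleN1r. Qed.

Lemma dmapB y u v : dmap pi y (u - v) = dmap pi y u - dmap pi y v.
Proof. by rewrite dmapD dmapN. Qed.

Lemma dmap0 y : dmap pi y 0 = 0.
Proof. by apply/rowP => j; rewrite !mxE der0v. Qed.

Lemma dmap_sum y (I : Type) (r : seq I) (F : I -> 'rV[R]_m) :
  dmap pi y (\sum_(i <- r) F i) = \sum_(i <- r) dmap pi y (F i).
Proof.
by elim: r => [|i r IH]; rewrite ?big_nil ?dmap0 // !big_cons dmapD IH.
Qed.

(** The usual [pi]-relatedness. Vertical fields are those related to the zero field, so one result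
    on brackets serves lifts and vertical fields alike. *)
Definition related (X : field M) (X' : field N) :=
  forall y, dmap pi y (X y) = X' (pi y).

Lemma act_related X X' h y : related X X' -> smooth_at h (pi y) ->
  act X (h \o pi) y = act X' h (pi y).
Proof. by move=> rX hh; rewrite /act der_dmap // rX. Qed.

Lemma act2_related X Y X' Y' h x : smooth_field X' -> smooth_field Y' ->
  related X X' -> related Y Y' -> smooth_at h (pi x) ->
  act X (act Y (h \o pi)) x = act X' (act Y' h) (pi x).
Proof.
move=> hX' hY' rX rY hh.
have [D [oD Dx hD]] := smooth_at_local hh.
have -> : act X (act Y (h \o pi)) x = act X (act Y' h \o pi) x.
  apply: (der_ext _ (open_preimage oD) Dx) => w Dw.
  by apply: act_related => //; exact: hD.
exact: (act_related rX (smooth_act hY' hh)).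
Qed.

(** Tested on coordinates of [N] pulled back to [M], on which related fields act as their images do
    downstairs. *)
Lemma bracket_related X Y X' Y' : smooth_field X -> smooth_field Y ->
  smooth_field X' -> smooth_field Y' ->
  related X X' -> related Y Y' -> related (bracket X Y) (bracket X' Y').
Proof.
move=> hX hY hX' hY' rX rY x; apply/rowP => j.
have hc : smooth_at (coord (pi x) j) (pi x) by exact/smooth_at_coord/dom_mem.
rewrite dmapE -[LHS]/(act (bracket X Y) (coord (pi x) j \o pi) x).
rewrite act_bracket //; last exact: smooth_at_comp.
by rewrite !mxE (act2_related hX' hY' rX rY hc) (act2_related hY' hX' rY rX hc).
Qed.

Lemma related0 X : vertical_field pi X <-> related X ((fun=> 0) : field N).
Proof. by []. Qed.

Lemma bracket0r (Z : field N) q : bracket Z ((fun=> 0) : field N) q = 0.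
Proof.
apply/rowP => j; rewrite !mxE [X in _ - X](_ : _ = 0) ?subr0; last exact: der0v.
rewrite /act (der_ext (A := setT) _ _ _ (g := fun=> 0)) //.
- exact: derive_cst.
- exact: openT.
- by move=> w _; exact: der0v.
Qed.

Lemma bracket_vertical X Y X' : smooth_field X -> smooth_field Y ->
  smooth_field X' -> related X X' -> vertical_field pi Y ->
  vertical_field pi (bracket X Y).
Proof.
move=> hX hY hX' rX /related0 vY x.
by rewrite /vertical (bracket_related hX hY hX' (@smooth_field0 _ _ N) rX vY)
  bracket0r.
Qed.

(** The transposed Jacobian of [pi], because tangent vectors are rows. *)
Definition dpi_mx x q (z : 'rV[R]_m) : 'M[R]_(m, p) :=
  \matrix_(a, j) 'D_(delta_mx 0 a) (coord q j \o pi \o ichart x) z.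

Lemma dpi_mxE x y q v : dom x y -> dom q (pi y) ->
  v *m dpi_mx x q (chart x y) = tcomp q (pi y) (dmap pi y (of_chart x y v)).
Proof.
move=> xy qy; apply/rowP => j.
rewrite !mxE -der_dmap; last exact: smooth_at_coord.
rewrite der_of_chart //; last exact: smooth_at_coord_pi.
rewrite (derive_rowE _ (@open_pi x q) _ (@smooth_pi x q j)); last first.
  by split; [exact: img_chart | rewrite /= chartK].
by apply: eq_bigr => a _; rewrite mxE.
Qed.

Definition gram_mx (g : form M) x (z : 'rV[R]_m) : 'M[R]_m :=
  \matrix_(a, b) ip g (ichart x z) (of_chart x (ichart x z) (delta_mx 0 a))
                     (of_chart x (ichart x z) (delta_mx 0 b)).

Lemma gram_mxE g x y u v : dom x y ->
  (u *m gram_mx g x (chart x y) *m v^T) ord0 ord0 =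
  ip g y (of_chart x y u) (of_chart x y v).
Proof.
move=> xy; rewrite ip_chart // mxE exchange_big /=; apply: eq_bigr => b _.
rewrite !mxE mulr_suml; apply: eq_bigr => a _.
by rewrite mxE chartK // -mulrA [X in _ * X]mulrC.
Qed.

Lemma gram_mx_unit g x y : riemannian_metric g -> dom x y ->
  [/\ gram_mx g x (chart x y) \in unitmx,
      (gram_mx g x (chart x y))^T = gram_mx g x (chart x y) &
      forall v : 'rV[R]_m, v != 0 ->
        0 < (v *m gram_mx g x (chart x y) *m v^T) ord0 ord0].
Proof.
move=> hg xy.
have pos v : v != 0 -> 0 < (v *m gram_mx g x (chart x y) *m v^T) ord0 ord0.
  move=> v0; rewrite gram_mxE //; apply: (metric_pos hg).
  apply: contraNneq v0 => ov.
  rewrite -(tcomp_of_chart v xy) ov; apply/eqP/rowP => j.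
  by rewrite !mxE der0v.
split=> //; last by apply/matrixP => a b; rewrite !mxE (metric_sym hg).
rewrite -row_free_unit -kermx_eq0; apply/eqP/row_matrixP => i.
rewrite row0; apply/eqP/contraT => /pos.
by rewrite -row_mul mulmx_ker row0 mul0mx mxE ltxx.
Qed.

Lemma tcomp_inj q (r : N) : dom q r -> injective (tcomp q r).
Proof. by move=> qr u v E; rewrite -(of_chart_tcomp u qr) E of_chart_tcomp. Qed.

Lemma schur_chart g x y q : riemannian_metric g ->
  (forall w : 'rV[R]_p, exists v, dmap pi y v = w) ->
  dom x y -> dom q (pi y) ->
  let P := dpi_mx x q (chart x y) in
  P^T *m invmx (gram_mx g x (chart x y)) *m P \in unitmx.
Proof.
move=> hg surj xy qy; have [uG sG pG] := gram_mx_unit hg xy.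
apply: schur_unit => // w; have [v vw] := surj (of_chart q (pi y) w).
exists (tcomp x y v); rewrite dpi_mxE // of_chart_tcomp // vw.
exact: tcomp_of_chart.
Qed.

Lemma hlift_chart g x y q (w : 'rV[R]_p) : riemannian_metric g ->
  (forall w : 'rV[R]_p, exists v, dmap pi y v = w) ->
  dom x y -> dom q (pi y) ->
  let u := of_chart x y (hlift_mx (gram_mx g x (chart x y))
             (dpi_mx x q (chart x y)) (tcomp q (pi y) w)) in
  horizontal pi g y u /\ dmap pi y u = w.
Proof.
move=> hg surj xy qy; have [uG _ _] := gram_mx_unit hg xy.
have uS := schur_chart hg surj xy qy.
split; last by apply: (tcomp_inj qy); rewrite -dpi_mxE // hlift_mxP.
move=> v vv; rewrite -(of_chart_tcomp v xy) -gram_mxE //.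
apply: hlift_mx_orth => //; rewrite dpi_mxE // of_chart_tcomp // vv.
by apply/rowP => j; rewrite !mxE der0v.
Qed.

Lemma horizontal_uniq g x (h h' : 'rV[R]_m) : riemannian_metric g ->
  horizontal pi g x h -> horizontal pi g x h' ->
  dmap pi x h = dmap pi x h' -> h = h'.
Proof.
move=> hg hh hh' E; apply/eqP; rewrite -subr_eq0; apply/eqP.
apply: (ip_eq0 hg (x := x)).
have vd : vertical pi x (h - h') by rewrite /vertical dmapB E subrr.
by rewrite [X in ip _ _ X _]/GRing.add /= ipBl hh // hh' // subrr.
Qed.

(** The horizontal lift is unique, so in charts it equals [hlift_mx], a rational expression in the
    Gram matrix, the Jacobian and the components of [W], all smooth in time and position. *)
Lemma smooth_lift_family (I : set R) (g : R -> form M) (W : field N)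
    (H : R -> field M) :
  open I -> smooth_form_family I g ->
  (forall t, I t -> riemannian_metric (g t)) ->
  (forall y (w : 'rV[R]_p), exists v, dmap pi y v = w) ->
  smooth_field W ->
  (forall t y, I t -> horizontal pi (g t) y (H t y) /\ dmap pi y (H t y) = W (pi
    y)) ->
  smooth_field_family I H.
Proof.
move=> oI hg mg surj hW hH x j.
apply: smooth_on_local => -[t z] [/= It xz].
pose q := pi (ichart x z).
pose D := preim x (pi @^-1` dom q).
have oD : open D := @open_pi x q.
exists (box I D); first by split => //; split=> //; exact: dom_mem.
pose w (z : 'rV[R]_m) : 'rV[R]_p :=
  \row_k (act W (coord q k) \o pi) (ichart x z).
apply: (smooth_on_ext (f := fun s : R * 'rV[R]_m =>
   hlift_mx (gram_mx (g s.1) x s.2) (dpi_mx x q s.2) (w s.2) ord0 j)).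
- exact: open_box.
- move=> [s z'] [/= Is [xz' qz']]; have yd := ichart_dom xz'.
  have [hh hd] := hlift_chart (W (pi (ichart x z'))) (mg _ Is) (surj _) yd qz'.
  have [Hh Hd] := hH s (ichart x z') Is.
  rewrite ichartK // in hh hd.
  have E := horizontal_uniq (mg _ Is) Hh hh (etrans Hd (esym hd)).
  rewrite /act E -[RHS]/(der _ _ (coord x j)).
  have -> : w z' = tcomp q (pi (ichart x z')) (W (pi (ichart x z'))).
    by apply/rowP => k; rewrite !mxE.
  have := tcomp_of_chart (hlift_mx (gram_mx (g s) x z') (dpi_mx x q z')
     (tcomp q (pi (ichart x z')) (W (pi (ichart x z'))))) yd.
  by move=> /rowP/(_ j); rewrite mxE => ->.
have oB : open (box I D) by exact: open_box.
have sG : smooth_mx (box I D) (fun s : R * 'rV[R]_m => gram_mx (g s.1) x s.2).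
  move=> a b; under eq_fun do rewrite mxE.
  by apply: smooth_on_sub (hg x _ _) => s [Is [xs _]].
have sP : smooth_mx (box I D) (fun s : R * 'rV[R]_m => dpi_mx x q s.2).
  move=> a b; under eq_fun do rewrite mxE.
  exact: (smooth_on_snd (I := I) (smooth_onS (delta_mx 0 a) (@smooth_pi x q
    b))).
have sw : smooth_mx (box I D) (fun s : R * 'rV[R]_m => w s.2).
  move=> a b; under eq_fun do rewrite mxE.
  have sW : smooth_on D ((act W (coord q b) \o pi) \o ichart x).
    apply: smooth_on_img => [z' []//|z' [xz' qz']].
    by apply: smooth_at_comp; move/smooth_fieldP: hW; exact.
  exact: (smooth_on_snd (I := I) sW).
have unitG s : box I D s -> gram_mx (g s.1) x s.2 \in unitmx.
  move=> [Is [xs _]].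
  by have [] := gram_mx_unit (mg _ Is) (ichart_dom xs); rewrite ichartK.
have sGi := smooth_invmx oB unitG sG.
have sPT := smooth_mxT sP.
have sPG := smooth_mxM oB sPT sGi.
apply: (smooth_mxM oB (smooth_mxM oB sw _) sPG).
apply: smooth_invmx => //; last exact: smooth_mxM.
move=> s [Is [xs qs]].
have := schur_chart (mg _ Is) (surj _) (ichart_dom xs) qs.
by rewrite ichartK.
Qed.

End SmoothMaps.

(** * Signs in derivatives and brackets *)

Section FieldSigns.
Context {R : realType} {m : nat} {M : manifold R m}.
Implicit Types (X Y : field M) (f : M -> R) (x : M).

Lemma act_const X f (c : R) x : (forall y, f y = c) -> act X f x = 0.
Proof.
by move=> fc; have -> : f = cst c; [exact/funext | exact: derive_cst].
Qed.

Lemma derNf x v f : smooth_at f x -> der x v (fun y => - f y) = - der x v f.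
Proof.
move=> hf; have [D [oD Dx Dxx sD]] := smooth_atP hf (dom_mem x).
have := is_deriveNf (derivableP (smooth_on_derivable (v := v) sD Dxx)).
by case.
Qed.

Lemma bracketNl X Y x : smooth_field X -> smooth_field Y ->
  bracket (fun y => - X y) Y x = - bracket X Y x.
Proof.
move=> hX hY; apply/rowP => j.
have hc : smooth_at (coord x j) x by exact/smooth_at_coord/dom_mem.
have E : act Y (act (fun y => - X y) (coord x j)) x = - act Y (act X (coord x
  j)) x.
  rewrite -[RHS]derNf; last exact: smooth_act.
  apply: (der_ext _ (dom_open x) (dom_mem x)) => w xw.
  by apply: derNv; exact: smooth_at_coord.
have F : act (fun y => - X y) (act Y (coord x j)) x = - act X (act Y (coord x
  j)) x.
  by apply: derNv; exact: smooth_act.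
apply: (etrans (bracketEx _ _ _ _ _)); rewrite F E mxE bracketEx.
by rewrite opprB opprK addrC.
Qed.

Lemma bracketNr X Y x : smooth_field X -> smooth_field Y ->
  bracket X (fun y => - Y y) x = - bracket X Y x.
Proof.
by move=> hX hY; rewrite bracketC (bracketNl _ hY hX) // opprK bracketC.
Qed.

End FieldSigns.

(** Orthonormality says that [gN y *m E^T] is a right inverse of the square matrix [E] of the frame;
    it is then a left inverse, which is the expansion. *)
Lemma orthonormal_expansion (R : realType) p (N : manifold R p) (gN : form N) y
    (e : 'I_p -> 'rV[R]_p) (w : 'rV[R]_p) :
  (forall i j, ip gN y (e i) (e j) = (i == j)%:R) ->
  w = \sum_j ip gN y w (e j) *: e j.
Proof.
move=> on; pose E : 'M[R]_p := \matrix_(i, j) e i ord0 j.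
have rE i : row i E = e i by apply/rowP => j; rewrite !mxE.
have EGE : E *m (gN y *m E^T) = 1%:M.
  apply/matrixP => i j; rewrite mulmxA [RHS]mxE -on /ip -!rE.
  rewrite -row_mul tr_row mxE [RHS]mxE.
  by apply: eq_bigr => k _; congr (_ * _); rewrite !mxE.
have GEE := mulmx1C EGE.
rewrite -{1}[w]mulmx1 -GEE !mulmxA mulmx_sum_row; apply: eq_bigr => j _.
rewrite rE; congr (_ *: _).
rewrite /ip -rE tr_row mxE [RHS]mxE.
by apply: eq_bigr => k _; rewrite [(col _ _) _ _]mxE.
Qed.

Lemma is_derive0_eq (R : realType) (f : R -> R) (eps t : R) : -eps < t < eps ->
  (forall s, -eps < s < eps -> is_derive s 1 f 0) -> f t = f 0.
Proof.
move=> ht hf.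
(* Differentiating along [t] itself lets the segment from [0] to [t] be parametrized by the unit
   interval, whatever the sign of [t]. *)
have Ht s : -eps < s < eps -> is_derive s t f 0.
  move=> /hf[df f0]; rewrite -[t]mulr1 -[t * 1]/(t *: 1).
  by apply: (is_derive_eq (is_deriveZv t df)); rewrite f0 mulr0.
have hr r : 0 <= r <= 1 -> -eps < 0 + r *: t < eps.
  move=> /andP[r0 r1]; rewrite add0r /GRing.scale /=.
  by move/andP: ht => [t1 t2]; apply/andP; split; nra.
have [r r01|c c01] := @MVT_line R _ f 0 t.
  by case: (Ht _ (hr _ r01)).
have [_ ->] := Ht _ (hr _ c01).
by rewrite add0r => /eqP; rewrite subr_eq0 => /eqP.
Qed.

(** Here [a], [b], [c], [d], [e], [f] stand for the products of [D X Y] with [H], [D X H] with [Y],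
    [D Y X] with [H], [D Y H] with [X], [D H X] with [Y] and [D H Y] with [X]. *)
Lemma koszul_arith (R : realType) (a b c d e f : R) :
  0 = a + b -> 0 = c + d -> a - c = 0 ->
  2 * a = - (e + f - (e - b) - (f - d)).
Proof. by lra. Qed.

Lemma half_arith (R : realType) (a b : R) : 0 = b + b -> a - b = 0 -> a = 0.
Proof. by lra. Qed.

Lemma antisym_arith (R : realType) (a b c d e f : R) :
  0 = a + b -> 0 = c + d -> 0 = e + f -> a - e = 0 -> c - f = 0 ->
  a = - (2^-1 * (b - d)).
Proof. by lra. Qed.

(** * Curvature of planes spanned by a horizontal and a vertical vector *)

Section FrameSubmersion.
Context {R : realType} {m p : nat} {M : manifold R m} {N : manifold R p}.
Variables (pi : M -> N) (g : form M) (gN : form N).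
Variables (hg : riemannian_metric g) (hpi : riemannian_submersion pi g gN).
Variable W : 'I_p -> field N.
Variable W_smooth : forall i, smooth_field (W i).
Variable W_on : forall i j y, ipf gN (W i) (W j) y = (i == j)%:R.
Variable H : 'I_p -> field M.
Variable H_smooth : forall i, smooth_field (H i).
Variable H_hor : forall i y, horizontal pi g y (H i y).
Variable H_lift : forall i y, dmap pi y (H i y) = W i (pi y).

Let sm := rs_smooth hpi.

Lemma lift_exists y (w : 'rV[R]_p) :
  exists h, horizontal pi g y h /\ dmap pi y h = w.
Proof.
have := @hlift_chart _ _ _ _ _ _ sm g y y (pi y) w hg (rs_submersion hpi y)
  (dom_mem _) (dom_mem _).
by move=> [hh hd]; eexists; split; [exact: hh|].
Qed.

(** Only the horizontal part of [v] pairs with [H k], and on horizontal vectors [dmap] is an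
    isometry. *)
Lemma ip_lift k y v : ip g y (H k y) v = ip gN (pi y) (W k (pi y)) (dmap pi y
  v).
Proof.
have [h [hh hd]] := lift_exists y (dmap pi y v).
have -> : v = h + (v - h) by rewrite addrC subrK.
have vv : vertical pi y (v - h) by rewrite /vertical (dmapB sm) hd subrr.
rewrite ipDr (@H_hor k y _ vv) addr0 (rs_isometry hpi (@H_hor k y) hh) H_lift.
by rewrite (dmapD sm) vv addr0.
Qed.

Lemma ip_lift_vert k y v : vertical pi y v -> ip g y v (H k y) = 0.
Proof. by move=> vv; rewrite (metric_sym hg) (@H_hor k y _ vv). Qed.

Lemma ip_lift_lift i j y : ip g y (H i y) (H j y) = (i == j)%:R.
Proof. by rewrite ip_lift H_lift; exact: W_on. Qed.

Lemma vertical_part y v :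
  vertical pi y (v - \sum_j ip g y v (H j y) *: H j y).
Proof.
rewrite /vertical (dmapB sm) (dmap_sum sm).
apply/eqP; rewrite subr_eq0; apply/eqP.
rewrite {1}(@orthonormal_expansion _ _ _ gN (pi y) (W ^~ (pi y)) (dmap pi y v)).
  apply: eq_bigr => j _; rewrite (dmapZ sm) H_lift (metric_sym hg) ip_lift.
  congr (_ *: _).
  have [h [hh hd]] := lift_exists y (dmap pi y v).
  by rewrite -hd -H_lift -!(rs_isometry hpi) // (metric_sym hg).
by move=> i j; exact: W_on.
Qed.

Lemma vertical_of_orth y v : (forall j, ip g y v (H j y) = 0) ->
  vertical pi y v.
Proof.
move=> v0; have := vertical_part y v.
by rewrite big1 ?subr0 // => j _; rewrite v0 scale0r.
Qed.

Variable D : field M -> field M -> field M.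
Variable hD : levi_civita g D.

Lemma bracket_lift_vertical k (Y : field M) : smooth_field Y ->
  vertical_field pi Y -> vertical_field pi (bracket (H k) Y).
Proof.
by move=> hY vY; exact: (bracket_vertical sm (H_smooth k) hY (W_smooth k)
  (H_lift k)).
Qed.

Lemma bracket_vert_vert (X Y : field M) : smooth_field X -> smooth_field Y ->
  vertical_field pi X -> vertical_field pi Y -> vertical_field pi (bracket X Y).
Proof.
by move=> hX hY vX vY; exact: (bracket_vertical sm hX hY (@smooth_field0 _ _ N)
  vX vY).
Qed.

(** The second fundamental form of the fibers in the direction [H j] is [-1/2] times the Lie
    derivative of the fiber metric along [H j]. The terms differentiating [ip X (H j)] and
    [ip Y (H j)] vanish, as does the horizontal part of [bracket X Y]. *)
Lemma koszul_vertical j (X Y : field M) x : smooth_field X -> smooth_field Y ->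
  vertical_field pi X -> vertical_field pi Y ->
  2 * ip g x (D X Y x) (H j x) =
  - (act (H j) (ipf g X Y) x - ipf g (bracket (H j) X) Y x
     - ipf g X (bracket (H j) Y) x).
Proof.
move=> hX hY vX vY; have hH := H_smooth j.
have e1 := lc_metric hD hX hY hH x.
rewrite (act_const _ (c := 0)) in e1; last by move=> y; exact: ip_lift_vert.
have e2 := lc_metric hD hY hX hH x.
rewrite (act_const _ (c := 0)) in e2; last by move=> y; exact: ip_lift_vert.
have e3 := lc_metric hD hH hX hY x.
have t1 := congr1 (fun v => ip g x v (Y x)) (lc_torsion hD hH hX x).
have t2 := congr1 (fun v => ip g x v (X x)) (lc_torsion hD hH hY x).
have t3 := congr1 (fun v => ip g x v (H j x)) (lc_torsion hD hX hY x).
rewrite /= [RHS]ip_lift_vert in t3; last exact: bracket_vert_vert.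
rewrite !ipBl in t1 t2 t3; rewrite /ipf in e1 e2 e3 *.
rewrite e3 -t1 [ip g x (X x) (bracket _ _ _)](metric_sym hg) -t2.
rewrite [ip g x (Y x) _](metric_sym hg) in e1.
rewrite [ip g x (X x) _](metric_sym hg) in e2.
rewrite [ip g x (X x) (D (H j) Y x)](metric_sym hg).
move: e1 e2 t3.
move: (ip g x (D X Y x) (H j x)) (ip g x (D X (H j) x) (Y x))
  (ip g x (D Y X x) (H j x)) (ip g x (D Y (H j) x) (X x))
  (ip g x (D (H j) X x) (Y x)) (ip g x (D (H j) Y x) (X x)).
exact: koszul_arith.
Qed.

Hypothesis tg : totally_geodesic_fibers pi D.

(** The bracket of [H i] with [A] is vertical, so [D (H i) A] may be replaced by [D A (H i)], which
    is orthogonal to the unit field [H i]. *)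
Lemma ip_nabla_lift_self i (A : field M) x : smooth_field A ->
  vertical_field pi A ->
  ip g x (D (H i) A x) (H i x) = 0.
Proof.
move=> hA vA; have hH := H_smooth i.
have e1 := lc_metric hD hA hH hH x.
rewrite (act_const _ (c := 1)) in e1; last first.
  by move=> y; rewrite /ipf ip_lift_lift eqxx.
have t1 := congr1 (fun v => ip g x v (H i x)) (lc_torsion hD hH hA x).
rewrite /= [RHS]ip_lift_vert in t1; last exact: bracket_lift_vertical.
rewrite ipBl in t1; rewrite /ipf [ip g x (H i x) _](metric_sym hg) in e1.
move: e1 t1.
move: (ip g x (D (H i) A x) (H i x)) (ip g x (D A (H i) x) (H i x)).
exact: half_arith.
Qed.

Section Plane.
Variables (U : field M) (i : 'I_p).
Hypotheses (hU : smooth_field U) (vU : vertical_field pi U).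

Let c j x := ip g x (D (H i) U x) (H j x).

(** O'Neill's antisymmetry: verticality of the brackets with [U] turns [c j] into the product of
    [D U (H i)] with [H j], which is antisymmetric in [i] and [j] because the frame products are
    constant. *)
Lemma ip_nabla_bracket j x :
  c j x = - (2^-1 * ip g x (bracket (H i) (H j) x) (U x)).
Proof.
have hi := H_smooth i; have hj := H_smooth j.
have e1 := lc_metric hD hi hU hj x.
rewrite (act_const _ (c := 0)) in e1; last by move=> y; exact: ip_lift_vert.
have e2 := lc_metric hD hj hU hi x.
rewrite (act_const _ (c := 0)) in e2; last by move=> y; exact: ip_lift_vert.
have e3 := lc_metric hD hU hi hj x.
rewrite (act_const _ (c := (i == j)%:R)) in e3; last by move=> y;
  exact: ip_lift_lift.
have t1 := congr1 (fun v => ip g x v (H j x)) (lc_torsion hD hi hU x).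
rewrite /= [RHS]ip_lift_vert in t1; last exact: bracket_lift_vertical.
have t2 := congr1 (fun v => ip g x v (H i x)) (lc_torsion hD hj hU x).
rewrite /= [RHS]ip_lift_vert in t2; last exact: bracket_lift_vertical.
have t3 := congr1 (fun v => ip g x v (U x)) (lc_torsion hD hi hj x).
rewrite /= in t3; rewrite !ipBl in t1 t2 t3; rewrite /ipf in e1 e2 e3.
rewrite -t3 /c.
rewrite [ip g x (U x) _](metric_sym hg) in e1.
rewrite [ip g x (U x) _](metric_sym hg) in e2.
rewrite [ip g x (H i x) _](metric_sym hg) in e3.
move: e1 e2 e3 t1 t2.
move: (ip g x (D (H i) U x) (H j x)) (ip g x (D (H i) (H j) x) (U x))
  (ip g x (D (H j) U x) (H i x)) (ip g x (D (H j) (H i) x) (U x))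
  (ip g x (D U (H i) x) (H j x)) (ip g x (D U (H j) x) (H i x)).
exact: antisym_arith.
Qed.

(* The vertical part [X] of [D (H i) U] is a global smooth field, so total
   geodesy applies to [D U X] without extending tangent vectors to fields. *)
Lemma curvature_lift x :
  ipf g (curvature D (H i) U U) (H i) x = \sum_j c j x ^+ 2.
Proof.
have hi := H_smooth i.
have hA : smooth_field (D U U) by exact: (lc_smooth hD).
have vA : vertical_field pi (D U U) by exact: tg.
have hB : smooth_field (D (H i) U) by exact: (lc_smooth hD).
have hC : smooth_field (bracket (H i) U) by exact: smooth_bracket.
have vC : vertical_field pi (bracket (H i) U) by exact: bracket_lift_vertical.
rewrite /ipf /curvature !ipBl ip_nabla_lift_self // sub0r.
rewrite [X in _ - X]ip_lift_vert ?subr0; last exact: tg.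
(* The product of [D (H i) U] with [H i] vanishes identically; its derivative along [U] moves [D U]
   from one factor to the other. *)
have e1 := lc_metric hD hU hB hi x.
rewrite (act_const _ (c := 0)) in e1; last by move=> y;
  exact: ip_nabla_lift_self.
have -> : - ip g x (D U (D (H i) U) x) (H i x) = ip g x (D (H i) U x) (D U (H i)
  x).
  by apply/eqP; rewrite eq_sym -addr_eq0 addrC -[X in X == _]e1.
pose X : field M := fun y => D (H i) U y - \sum_j c j y *: H j y.
have hc j y : smooth_at (c j) y.
  by apply: smooth_ipf hB (H_smooth j); exact: metric_smooth.
have hX : smooth_field X.
  apply: (smooth_fieldB hB); apply: smooth_field_sum => j.
  exact: (smooth_fieldZ (hc j) (H_smooth j)).
have vX : vertical_field pi X by move=> y; exact: vertical_part.
(* As [D U X] is vertical, differentiating the zero product of [X] and [H i] shows that [X] is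
   orthogonal to [D U (H i)]: only the horizontal part of [D (H i) U] contributes. *)
have e2 := lc_metric hD hU hX hi x.
rewrite (act_const _ (c := 0)) in e2; last by move=> y; exact: ip_lift_vert.
rewrite {1}/ipf [X in X + _]ip_lift_vert ?add0r in e2; last exact: tg.
have -> : D (H i) U x = X x + \sum_j c j x *: H j x by rewrite subrK.
rewrite ipDl -[X in X + _]e2 add0r ip_suml; apply: eq_bigr => j _.
rewrite ipZl expr2; congr (_ * _).
(* [D U (H i)] and [D (H i) U] differ by a vertical bracket, so both have the component [c j] along
   [H j]; hence the squares. *)
have := congr1 (fun v => ip g x v (H j x)) (lc_torsion hD hi hU x).
rewrite /= [RHS]ip_lift_vert // ipBl => /eqP; rewrite subr_eq0 => /eqP E.
rewrite /c E; exact: (metric_sym hg).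
Qed.

Lemma sec_lift x : ipf g U U x * sec g D (H i) U x =
  4^-1 * \sum_j ipf g (bracket (H i) (H j)) U x ^+ 2.
Proof.
rewrite /sec curvature_lift.
have -> : ipf g (H i) (H i) x = 1 by rewrite /ipf ip_lift_lift eqxx.
have -> : ipf g (H i) U x = 0 by exact: H_hor.
rewrite mul1r expr0n subr0 mulr_sumr.
have E : \sum_j c j x ^+ 2 =
    \sum_j 4^-1 * ipf g (bracket (H i) (H j)) U x ^+ 2.
  apply: eq_bigr => j _; rewrite ip_nabla_bracket /ipf.
  move: (ip _ _ _ _) => a; by field.
(* The denominator of [sec] has become [ipf g U U x]. Where [U] vanishes both sides are [0];
   elsewhere the factor cancels it. *)
rewrite E; have [U0|U0] := eqVneq (U x) 0.
  rewrite /ipf U0 ip0r mul0r big1 // => j _.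
  by rewrite ip0r expr0n mulr0.
rewrite mulrC divfK // gt_eqF //; exact: (metric_pos hg).
Qed.

End Plane.

End FrameSubmersion.

(** * Existence behind the choices in [hlift] and [hproj] *)

Section HorizontalProjection.
Context {R : realType} {m p : nat} {M : manifold R m} {N : manifold R p}.
Variables (pi : M -> N) (g : form M) (gN : form N).
Hypotheses (hg : riemannian_metric g) (hpi : riemannian_submersion pi g gN).

Lemma hliftP (W : field N) x :
  horizontal pi g x (hlift pi g W x) /\ dmap pi x (hlift pi g W x) = W (pi x).
Proof.
rewrite /hlift; case: xgetP => [h _ //|H].
by have [h hh] := lift_exists hg hpi x (W (pi x)); case: (H h).
Qed.

Lemma hprojP x v :
  horizontal pi g x (hproj pi g x v) /\ dmap pi x (hproj pi g x v) = dmap pi x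
    v.
Proof.
have dB := dmapB (rs_smooth hpi).
rewrite /hproj; case: xgetP => [h _ [hh /eqP]|H].
  by rewrite dB subr_eq0 => /eqP.
have [h [hh hd]] := lift_exists hg hpi x (dmap pi x v); case: (H h).
by split=> //; rewrite /vertical dB hd subrr.
Qed.

End HorizontalProjection.

Lemma killing_arith (R : realType) (a b c : R) :
  a - b - c = 0 -> - a + b + c = 0.
Proof. by lra. Qed.

Lemma dq_arith (R : realType) (s a b v : R) :
  s - (a - v + (- v + b)) = s - a - b + 2 * v.
Proof. by ring. Qed.

Lemma quarter_arith (R : realType) (a b : R) :
  4^-1 * (b * a + a * b) = 2^-1 * (a * b).
Proof. by field. Qed.

(** * Variations of the metric *)

Section Variation.
Context {R : realType} {m p : nat} {M : manifold R m} {N : manifold R p}.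
Variables (pi : M -> N) (g0 : form M) (gN : form N) (eps : R).
Local Notation I := [set` `]-eps, eps[].
Variable g : R -> form M.
Hypothesis g_smooth : smooth_form_family I g.
Hypothesis g_riem : forall t : R, -eps < t < eps -> riem_vertical pi g0 (g t).
Hypothesis g_subm : forall t : R, -eps < t < eps ->
  riemannian_submersion pi (g t) gN.
Variable W : 'I_p -> field N.
Hypothesis W_smooth : forall i, smooth_field (W i).
Hypothesis W_on : forall i j y, ipf gN (W i) (W j) y = (i == j)%:R.
Variable H : R -> 'I_p -> field M.
Hypothesis H_hor : forall (t : R) i y, -eps < t < eps ->
  horizontal pi (g t) y (H t i y).
Hypothesis H_lift : forall (t : R) i y, -eps < t < eps ->
  dmap pi y (H t i y) = W i (pi y).
Variable V : R -> 'I_p -> field M.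
Hypothesis V_smooth : forall i, smooth_field_family I (V ^~ i).
Hypothesis V_vertical : forall (t : R) i, -eps < t < eps ->
  vertical_field pi (V t i).
Hypothesis hB : forall t : R, -eps < t < eps -> forall x v, vertical pi x v ->
    sharp (g t) (dt_form g t) x v = \sum_(i < p) ip g0 x (V t i x) v *: H t i x.
Variable eps_gt0 : 0 < eps.

Lemma mem_I (t : R) : -eps < t < eps -> I t.
Proof. by rewrite /= in_itv. Qed.

Lemma of_I (t : R) : I t -> -eps < t < eps.
Proof. by rewrite /= in_itv. Qed.

Lemma open_I : open I.
Proof. exact: itv_open. Qed.

Lemma mem0 : -eps < 0 < eps.
Proof. by rewrite oppr_lt0 eps_gt0. Qed.

Let sm : smooth_map pi := rs_smooth (g_subm mem0).

Lemma H_family i : smooth_field_family I (H ^~ i).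
Proof.
apply: (smooth_lift_family sm open_I g_smooth (W := W i)) => //.
- by move=> t /of_I/g_riem[].
- exact: rs_submersion (g_subm mem0).
- by move=> t y /of_I It; split; [exact: H_hor | exact: H_lift].
Qed.

Lemma H_smooth (t : R) i : -eps < t < eps -> smooth_field (H t i).
Proof. by move=> It; exact: (family_field (H_family i) (mem_I It)). Qed.

Lemma V_smooth_at (t : R) i : -eps < t < eps -> smooth_field (V t i).
Proof. by move=> It; exact: (family_field (V_smooth i) (mem_I It)). Qed.

Lemma dt_ip (A B : R -> 'rV[R]_m) dA dB (t : R) x : -eps < t < eps ->
  is_derive t 1 A dA -> is_derive t 1 B dB ->
  is_derive t 1 (fun s => ip (g s) x (A s) (B s))
    (ip (dt_form g t) x (A t) (B t) + ip (g t) x dA (B t) + ip (g t) x (A t)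
      dB).
Proof.
by move=> It hA hB'; exact: (is_derive_ip x g_smooth (mem_I It) hA hB').
Qed.

Lemma near_I (t : R) : -eps < t < eps -> \forall s \near t, -eps < s < eps.
Proof.
move=> It; have : nbhs t I by apply: open_nbhs_nbhs; split;
  [exact: open_I | exact: mem_I].
by apply: filterS => s /of_I.
Qed.

Lemma dt_form_sym (t : R) x v w : -eps < t < eps ->
  ip (dt_form g t) x v w = ip (dt_form g t) x w v.
Proof.
move=> It.
have d u u' := dt_ip x It (is_derive_cst u t 1) (is_derive_cst u' t 1).
have [_] := d v w; rewrite ip0l ip0r !addr0 => <-.
have [_] := d w v; rewrite ip0l ip0r !addr0 => <-.
apply: near_eq_derive; apply: filterS (near_I It) => s /g_riem[hg _].
exact: (metric_sym hg).
Qed.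

(** The symmetric form is read as the product of [sharp v] with [w]; by [ip_lift], each [H t k] sees
    only the projection of [w]. *)
Lemma dt_form_vertical (t : R) x v w : -eps < t < eps -> vertical pi x v ->
  ip (dt_form g t) x w v =
  \sum_(k < p) ip gN (pi x) (W k (pi x)) (dmap pi x w) * ip g0 x (V t k x) v.
Proof.
move=> It vv; have [hg _] := g_riem It.
rewrite dt_form_sym // -(sharpP (dt_form g t) x v w hg) hB // ip_suml.
apply: eq_bigr => k _; rewrite ipZl mulrC; congr (_ * _).
by apply: (ip_lift hg (g_subm It)) => i y; [exact: H_hor | exact: H_lift].
Qed.

Lemma dt_form_vertical2 (t : R) x v w : -eps < t < eps -> vertical pi x v ->
  vertical pi x w -> ip (dt_form g t) x w v = 0.
Proof.
move=> It vv vw; rewrite dt_form_vertical // big1 // => k _.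
by rewrite vw ip0r mul0r.
Qed.

Lemma ip_vertical (t : R) x v w : -eps < t < eps -> vertical pi x v ->
  vertical pi x w ->
  ip (g t) x v w = ip g0 x v w.
Proof. by move=> /g_riem[_ h]; exact: h. Qed.

(* Differentiating [g_t(W_i^t, v) = 0] and [dpi W_i^t = W_i] shows that
   [dW_i^t/dt + V_i] is vertical and orthogonal to the fibers. *)
Lemma dt_H (t : R) i x : -eps < t < eps -> dt_field (H ^~ i) t x = - V t i x.
Proof.
move=> It; have [hg _] := g_riem It.
have dH := is_derive_family x (H_family i) (mem_I It).
have vd : vertical pi x (dt_field (H ^~ i) t x).
  apply/rowP => j; rewrite mxE [RHS]mxE.
  have fs : smooth_at (coord (pi x) j \o pi) x.
    exact/(smooth_at_coord_pi sm)/dom_mem.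
  have [_ <-] := is_derive_der fs dH.
  rewrite -(derive_cst (W i (pi x) ord0 j) t 1); apply: near_eq_derive.
  apply: filterS (near_I It) => s Is.
  by rewrite -dmapE H_lift.
have vD : vertical pi x (dt_field (H ^~ i) t x + V t i x).
  by rewrite /vertical (dmapD sm) vd (V_vertical i It) addr0.
apply/eqP; rewrite -addr_eq0; apply/eqP; apply: (ip_eq0 hg (x := x)).
set v := _ + _ in vD *.
(* With [v] frozen at its value at time [t], the derivative of [g_s(W_i^s, v) = 0] has a metric
   term, equal to [g0(V_i, v)] by orthonormality of [W], and a term in [dW_i/dt]; together they are
   the square norm of [v]. *)
have [_ E] := dt_ip x It dH (is_derive_cst v t 1).
have E0 : 'D_1 (fun s => ip (g s) x (H s i x) (cst v s)) t = 0.
  rewrite -(derive_cst (0 : R) t 1); apply: near_eq_derive.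
  by apply: filterS (near_I It) => s Is; exact: H_hor.
move: E; rewrite E0 ip0r addr0 dt_form_vertical // H_lift //.
rewrite (bigD1 i) //= [X in _ + X + _]big1 => [|k ki]; last first.
  by rewrite -/(ipf gN (W k) (W i) (pi x)) W_on (negbTE ki) mul0r.
rewrite -/(ipf gN (W i) (W i) (pi x)) W_on eqxx mul1r addr0.
move=> E; rewrite {1}/v ipDl addrC (ip_vertical It (@V_vertical t i It x) vD).
by rewrite -E.
Qed.

Lemma dt_H_fun (t : R) i : -eps < t < eps ->
  dt_field (H ^~ i) t = (fun y => - V t i y).
Proof. by move=> It; apply/funext => y; exact: dt_H. Qed.

Lemma bracket_HV (t : R) i (Y : field M) : -eps < t < eps -> smooth_field Y ->
  vertical_field pi Y -> vertical_field pi (bracket (H t i) Y).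
Proof.
move=> It hY vY; apply: (bracket_vertical sm (H_smooth i It) hY (W_smooth i)) =>
  //.
by move=> y; exact: H_lift.
Qed.

Lemma bracket_VH (t : R) i (Y : field M) : -eps < t < eps -> smooth_field Y ->
  vertical_field pi Y -> vertical_field pi (bracket Y (H t i)).
Proof.
move=> It hY vY y; rewrite bracketC /vertical (dmapN sm).
by rewrite (@bracket_HV t i Y It hY vY y) oppr0.
Qed.

(** * Persistence of totally geodesic fibers *)

Section TotallyGeodesic.
Variable nabla : R -> field M -> field M -> field M.
Hypothesis nablaP : forall t : R, -eps < t < eps -> levi_civita (g t) (nabla t).
Hypothesis V_killing : forall (t : R) i, -eps < t < eps ->
  killing_on_fibers pi g0 (V t i).
Hypothesis g_at0 : g 0 = g0.
Hypothesis fibers_tg : totally_geodesic_fibers pi (nabla 0).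

(** The Lie derivative of the fiber metric along [W_j^t]. For vertical [X], [Y] the brackets are
    vertical, so [g0] may stand for [g t], and time enters only through [H t j]. *)
Let lie t j (X Y : field M) x :=
  act (H t j) (ipf g0 X Y) x - ip g0 x (bracket (H t j) X x) (Y x)
    - ip g0 x (X x) (bracket (H t j) Y x).

Lemma ipf_vertical (t : R) (X Y : field M) : -eps < t < eps ->
  vertical_field pi X -> vertical_field pi Y -> ipf (g t) X Y = ipf g0 X Y.
Proof. by move=> It vX vY; apply/funext => y; exact: ip_vertical. Qed.

Lemma nabla_lie (t : R) j (X Y : field M) x : -eps < t < eps ->
  smooth_field X -> smooth_field Y -> vertical_field pi X ->
    vertical_field pi Y ->
  2 * ip (g t) x (nabla t X Y x) (H t j x) = - lie t j X Y x.
Proof.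
move=> It hX hY vX vY; have [hg _] := g_riem It.
rewrite (koszul_vertical hg (g_subm It) (fun i => H_smooth i It)
  (fun i y => @H_hor t i y It) (nablaP It) j x hX hY vX vY).
rewrite ipf_vertical // /lie /ipf !(ip_vertical It) //.
- exact: bracket_HV.
- exact: bracket_HV.
Qed.

(* [d/dt] of the Lie derivative of the fiber metric along [W_j^t] is minus the
   Lie derivative along [V_j], which vanishes by the Killing equation. *)
Lemma dt_lie (t : R) j (X Y : field M) x : -eps < t < eps ->
  smooth_field X -> smooth_field Y -> vertical_field pi X ->
    vertical_field pi Y ->
  is_derive t 1 (fun s => lie s j X Y x) 0.
Proof.
move=> It hX hY vX vY; have Im := mem_I It.
have sg0 : smooth_form g0 by rewrite -g_at0; case: (g_riem mem0) => -[].
have d1 := is_derive_act (H_family j) Im (smooth_ipf x sg0 hX hY).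
have dbr (Z : field M) (hZ : smooth_field Z) :
    is_derive t 1 (fun s => bracket (H s j) Z x) (- bracket (V t j) Z x).
  have b := is_derive_bracket open_I x (H_family j) (family_cst hZ) Im.
  apply: (is_derive_eq b).
  have dZ0 : dt_field (fun=> Z) t = fun=> 0 :> 'rV[R]_m.
    by apply/funext => y; rewrite /dt_field derive1_cst.
  by rewrite dZ0 bracket0r addr0 (dt_H_fun j It) (bracketNl x (@V_smooth_at t j
    It) hZ).
have dip (A B : R -> 'rV[R]_m) dA dB : is_derive t 1 A dA ->
  is_derive t 1 B dB ->
    is_derive t 1 (fun s => ip g0 x (A s) (B s)) (ip g0 x dA (B t) + ip g0 x (A
      t) dB).
  move=> hA hB'; apply: (is_derive_eq (is_derive_quad (is_derive_cst (g0 x) t 1)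
    hA hB')).
  by rewrite mulmx0 mul0mx mxE add0r.
have d2 := dip _ _ _ _ (dbr X hX) (is_derive_cst (Y x) t 1).
have d3 := dip _ _ _ _ (is_derive_cst (X x) t 1) (dbr Y hY).
apply: (is_derive_eq (is_deriveBf (is_deriveBf d1 d2) d3)).
rewrite ip0r ip0l addr0 add0r ipNl ipNr !opprK dt_H_fun //.
have := V_killing j It hX hY vX vY x; rewrite /ipf.
rewrite {2}/act derNv; last exact: smooth_ipf.
exact: killing_arith.
Qed.

(** At time [0] total geodesy gives [lie = 0]; constancy in time carries this to [t], where
    [nabla_lie] says that [nabla t X Y] has no component along any [H t j]. *)
Lemma tg_variation (t : R) : -eps < t < eps ->
  totally_geodesic_fibers pi (nabla t).
Proof.
move=> It X Y hX hY vX vY x; have [hg _] := g_riem It.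
apply: (vertical_of_orth hg (g_subm It) W_on (fun i y => @H_hor t i y It)
  (fun i y => @H_lift t i y It)) => j.
have l0 : lie 0 j X Y x = 0.
  have := nabla_lie j x mem0 hX hY vX vY.
  have [hg' _] := g_riem mem0.
  rewrite (metric_sym hg') (H_hor j mem0 (fibers_tg hX hY vX vY x)) mulr0.
  by move=> /eqP; rewrite eq_sym oppr_eq0 => /eqP.
have := nabla_lie j x It hX hY vX vY.
have -> : lie t j X Y x = lie 0 j X Y x.
  apply: (@is_derive0_eq _ (fun s => lie s j X Y x) eps t It) => s Is.
  exact: dt_lie.
by rewrite l0 oppr0 => /eqP; rewrite mulf_eq0 pnatr_eq0 /= => /eqP.
Qed.

End TotallyGeodesic.

(** * Derivatives of the bracket terms *)

Section Integrand.
Variables (U : field M) (i : 'I_p) (x : M).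
Hypotheses (hU : smooth_field U) (vU : vertical_field pi U).

Let q j s := ipf (g s) (bracket (H s i) (H s j)) U x.

Let dq j s := \sum_(k < p) ipf gN (bracket (W i) (W j)) (W k) (pi x) *
    ipf g0 (V s k) U x
  - ip (g s) x (bracket (V s i) (H s j) x + bracket (H s i) (V s j) x) (U x).

(** The derivative of the metric sees the bracket of the lifts only through its projection, the
    bracket of [W i] and [W j]; the derivative of the bracket replaces each lift by minus its
    [V]. *)
Lemma is_derive_q j (t : R) : (forall y v w, ip gN y v w = ip gN y w v) ->
  -eps < t < eps -> is_derive t 1 (q j) (dq j t).
Proof.
move=> gN_sym It; have Im := mem_I It.
have b := is_derive_bracket open_I x (H_family i) (H_family j) Im.
rewrite (dt_H_fun i It) (dt_H_fun j It) in b.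
rewrite (bracketNl x (@V_smooth_at t i It) (@H_smooth t j It)) in b.
rewrite (bracketNr x (@H_smooth t i It) (@V_smooth_at t j It)) in b.
apply: (is_derive_eq (dt_ip x It b (is_derive_cst (U x) t 1))).
rewrite ip0r addr0 dt_form_vertical // /dq; congr (_ + _).
  apply: eq_bigr => k _; rewrite gN_sym; congr (ip _ _ _ _ * _).
  exact: (bracket_related sm (H_smooth i It) (H_smooth j It) (W_smooth i)
    (W_smooth j) (fun y => @H_lift t i y It) (fun y => @H_lift t j y It)).
by rewrite -opprD ipNl.
Qed.

(** No term in [dt_form] survives, since the brackets of [V] with lifts are vertical, like [U]. Each
    of the two brackets contributes one [- bracket (V t i) (V t j)], hence the factor [2]. *)
Lemma is_derive_dq j (t : R) : -eps < t < eps ->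
  is_derive t 1 (dq j)
   (\sum_(l < p) ipf gN (bracket (W i) (W j)) (W l) (pi x) *
      ipf g0 (dt_field (V ^~ l) t) U x
    - ipf (g t) (bracket (dt_field (V ^~ i) t) (H t j)) U x
    - ipf (g t) (bracket (H t i) (dt_field (V ^~ j) t)) U x
    + 2 * ipf (g t) (bracket (V t i) (V t j)) U x).
Proof.
move=> It; have Im := mem_I It.
have b1 := is_derive_bracket open_I x (V_smooth i) (H_family j) Im.
have b2 := is_derive_bracket open_I x (H_family i) (V_smooth j) Im.
rewrite (dt_H_fun j It) (bracketNr x (@V_smooth_at t i It) (@V_smooth_at t j
  It)) in b1.
rewrite (dt_H_fun i It) (bracketNl x (@V_smooth_at t i It) (@V_smooth_at t j
  It)) in b2.
have d2 := dt_ip x It (is_deriveD b1 b2) (is_derive_cst (U x) t 1).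
have d1 : is_derive t 1 (fun s => \sum_(k < p)
    ipf gN (bracket (W i) (W j)) (W k) (pi x) * ipf g0 (V s k) U x)
    (\sum_(l < p) ipf gN (bracket (W i) (W j)) (W l) (pi x) *
      ipf g0 (dt_field (V ^~ l) t) U x).
  apply: is_derive_sumf => k.
  have dV := is_derive_family x (V_smooth k) Im.
  have d := is_derive_quad (is_derive_cst (g0 x) t 1) dV (is_derive_cst (U x) t
    1).
  apply: (is_derive_eq (is_deriveMf (is_derive_cst _ t 1) d)).
  by rewrite mul0r add0r mulmx0 mul0mx trmx0 mulmx0 mxE add0r addr0.
apply: (is_derive_eq (is_deriveBf d1 d2)).
rewrite ip0r addr0 dt_form_vertical2 //; last first.
  rewrite /vertical (dmapD sm).
  have v1 := @bracket_VH t j _ It (@V_smooth_at t i It) (@V_vertical t i It) x.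
  have v2 := @bracket_HV t i _ It (@V_smooth_at t j It) (@V_vertical t j It) x.
  exact: (etrans (congr2 +%R v1 v2) (addr0 0)).
rewrite add0r !ipDl !ipNl /ipf.
exact: dq_arith.
Qed.

End Integrand.

End Variation.

(** * First and second variation of the curvature *)

Theorem theorem4p2 (R : realType) (n p : nat)
  (M : manifold R (n + p)) (N : manifold R p)
  (connM : connected [set: M]) (connN : connected [set: N])
  (orM : oriented M) (orN : oriented N)
  (pi : M -> N) (g0 : form M) (gN : form N)
  (hg0 : riemannian_metric g0) (hgN : riemannian_metric gN)
  (hpi0 : riemannian_submersion pi g0 gN)
  (eps : R) (heps : 0 < eps)
  (g : R -> form M)
  (g_at0 : g 0 = g0)
  (g_smooth : smooth_form_family `]-eps, eps[ g)
  (g_riem : forall t, -eps < t < eps -> riem_vertical pi g0 (g t))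
  (g_subm : forall t, -eps < t < eps -> riemannian_submersion pi (g t) gN)
  (nabla : R -> field M -> field M -> field M)
  (nablaP : forall t, -eps < t < eps -> levi_civita (g t) (nabla t))
  (W : 'I_p -> field N)
  (W_smooth : forall i, smooth_field (W i))
  (W_orthonormal : forall i j y, ipf gN (W i) (W j) y = (i == j)%:R)
  (Wt : R -> 'I_p -> field M)
  (WtE : forall t i x, Wt t i x = hproj pi (g t) x (hlift pi g0 (W i) x))
  (V : R -> 'I_p -> field M)
  (V_smooth : forall i, smooth_field_family `]-eps, eps[ (V ^~ i))
  (V_vertical : forall t i, -eps < t < eps -> vertical_field pi (V t i))
  (V_bounded : forall t i, -eps < t < eps -> bounded_field g0 (V t i))
  (V_killing : forall t i, -eps < t < eps -> killing_on_fibers pi g0 (V t i))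
  (hB : forall t, -eps < t < eps -> forall x v, vertical pi x v ->
    sharp (g t) (dt_form g t) x v =
      \sum_(i < p) ip g0 x (V t i x) v *: Wt t i x)
  (fibers_tg : totally_geodesic_fibers pi (nabla 0))
  (U : field M) (U_smooth : smooth_field U) (U_vertical : vertical_field pi U)
  (i : 'I_p) (t : R) (ht : -eps < t < eps) (x : M) :
  let dV l := dt_field (V ^~ l) t in
  (* the sectional curvature of the plane spanned by W_i^t and U, times the
     factor g0(U, U), which is 1 when U is of unit length at x; the right-hand
     sides are quadratic in U *)
  let S s := ipf g0 U U x * sec (g s) (nabla s) (Wt s i) U x in
  is_derive t 1 S
    (2^-1 * \sum_(j < p) ipf (g t) (bracket (Wt t i) (Wt t j)) U x *
      (\sum_(k < p)
          ipf gN (bracket (W i) (W j)) (W k) (pi x) * ipf g0 (V t k) U x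
       - ip (g t) x (bracket (V t i) (Wt t j) x + bracket (Wt t i) (V t j) x)
           (U x)))
  /\
  is_derive t 1 (derive1 S)
    (2^-1 * \sum_(j < p)
      (\sum_(l < p)
          ipf gN (bracket (W i) (W j)) (W l) (pi x) * ipf g0 (V t l) U x
       - ip (g t) x (bracket (V t i) (Wt t j) x + bracket (Wt t i) (V t j) x)
           (U x)) ^+ 2
     + 2^-1 * \sum_(j < p) ipf (g t) (bracket (Wt t i) (Wt t j)) U x *
      (\sum_(l < p)
          ipf gN (bracket (W i) (W j)) (W l) (pi x) * ipf g0 (dV l) U x
       - ipf (g t) (bracket (dV i) (Wt t j)) U x
       - ipf (g t) (bracket (Wt t i) (dV j)) U x
       + 2 * ipf (g t) (bracket (V t i) (V t j)) U x)).
Proof.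
move=> dV S.
(* Projecting along the fibers does not change the image under [dmap], so [Wt s k] is the
   [g s]-horizontal lift of [W k]; the rest uses only this characterization. *)
have Wt_hor (s : R) k y : -eps < s < eps -> horizontal pi (g s) y (Wt s k y).
  move=> Is; rewrite WtE; have [hg _] := g_riem _ Is.
  by have [] := hprojP hg (g_subm _ Is) y (hlift pi g0 (W k) y).
have Wt_lift (s : R) k y : -eps < s < eps -> dmap pi y (Wt s k y) = W k (pi y).
  move=> Is; rewrite WtE; have [hg _] := g_riem _ Is.
  have [_ ->] := hprojP hg (g_subm _ Is) y (hlift pi g0 (W k) y).
  by have [] := hliftP hg0 hpi0 (W k) y.
have gN_sym y v w : ip gN y v w = ip gN y w v by exact: (metric_sym hgN).
pose q j s := ipf (g s) (bracket (Wt s i) (Wt s j)) U x.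
have tg (s : R) : -eps < s < eps -> totally_geodesic_fibers pi (nabla s).
  exact: (tg_variation g_smooth g_riem g_subm W_smooth W_orthonormal Wt_hor
    Wt_lift
    V_smooth V_vertical hB heps nablaP V_killing g_at0 fibers_tg).
have SE (s : R) : -eps < s < eps -> S s = 4^-1 * \sum_j q j s ^+ 2.
  move=> Is; have [hg hv] := g_riem _ Is.
  have hH k := H_smooth g_smooth g_riem g_subm W_smooth Wt_hor Wt_lift heps k
    Is.
  rewrite /S /q -(sec_lift hg (g_subm _ Is) W_smooth W_orthonormal hH
    (fun k y => Wt_hor s k y Is) (fun k y => Wt_lift s k y Is) (nablaP _ Is) (tg
      s Is)
    i U_smooth U_vertical x).
  (* [U] is vertical, so the factor [g_s(U, U)] of [sec_lift] is the time-independent [g0(U, U)] in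
     [S]. *)
  by rewrite /ipf hv.
have q1 j (s : R) (Is : -eps < s < eps) :=
  is_derive_q g_smooth g_riem g_subm W_smooth
  W_orthonormal Wt_hor Wt_lift V_smooth V_vertical hB heps i x U_vertical j
    gN_sym Is.
have q2 j (s : R) (Is : -eps < s < eps) :=
  is_derive_dq g_smooth g_riem g_subm W_smooth
  W_orthonormal Wt_hor Wt_lift V_smooth V_vertical hB heps i x U_vertical j Is.
pose dq j s := \sum_(k < p) ipf gN (bracket (W i) (W j)) (W k) (pi x) *
    ipf g0 (V s k) U x
  - ip (g s) x (bracket (V s i) (Wt s j) x + bracket (Wt s i) (V s j) x) (U x).
have S1 (s : R) : -eps < s < eps ->
  is_derive s 1 S (2^-1 * \sum_j q j s * dq j s).
  move=> Is.
  have d : is_derive s 1 (fun r => 4^-1 * \sum_j q j r ^+ 2) 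
      (2^-1 * \sum_j q j s * dq j s).
    have d2 : is_derive s 1 (fun r => \sum_j q j r * q j r)
        (\sum_j (dq j s * q j s + q j s * dq j s)).
      by apply: is_derive_sumf => j; apply: is_deriveMf; exact: q1.
    apply: (is_derive_eq (is_deriveMf (is_derive_cst (4^-1 : R) s 1) d2)).
    rewrite mul0r add0r !mulr_sumr; apply: eq_bigr => j _.
    exact: quarter_arith.
  by apply: near_eq_is_derive d; apply: filterS (near_I Is) => r Ir; rewrite SE.
split; first exact: S1.
have d : is_derive t 1 (fun s => 2^-1 * \sum_j q j s * dq j s) _ :=
  is_deriveMf (is_derive_cst (2^-1 : R) t 1)
    (is_derive_sumf (index_enum _) (fun j => is_deriveMf (q1 j t ht) (q2 j t
      ht))).
(* Differentiating again requires the first derivative at all times near [t], which [S1] supplies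
   because the interval is open. *)
have nd : \forall s \near t, 2^-1 * \sum_j q j s * dq j s = derive1 S s.
  by apply: filterS (near_I ht) => s Is; rewrite derive1E;
    have [_ ->] := S1 s Is.
apply: (is_derive_eq (near_eq_is_derive nd d)).
rewrite mul0r add0r big_split /= mulrDr; congr (_ * _ + _).
Qed.
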